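(* Let $-\infty\le a<b\le\infty$ and let $p,q,r$ be Lebesgue measurable functions on $(a,b)$ with $p>0$ and $r>0$ a.e. on $(a,b)$, $q$ real-valued, and $1/p,\,q,\,r\in L^1_{loc}((a,b);dx)$. Let $$\ell=\frac1r\Big(-\frac{d}{dx}p\frac{d}{dx}+q\Big)\quad\text{on }(a,b).$$ (i) If $\ell$ is nonoscillatory and in the limit point case at $a$, then there exists $\lambda_a\in\mathbb{R}$ such that for all $\lambda<\lambda_a$ and all $x,x_0\in(a,b)$ lying to the left of the first zero of $\psi_-(\lambda,\cdot)$ and of $u_a(\lambda,\cdot)$ (if any), $$\psi_-(\lambda,x)\,\psi_-(\lambda,x_0)^{-1}=u_a(\lambda,x)\,u_a(\lambda,x_0)^{-1},$$ that is, $\psi_-(\lambda,\cdot)$ and $u_a(\lambda,\cdot)$, $\lambda<\lambda_a$, are constant multiples of each other. (ii) If $\ell$ is nonoscillatory and in the limit point case at $b$, then there exists $\lambda_b\in\mathbb{R}$ such that for all $\lambda<\lambda_b$ and all $x,x_0\in(a,b)$ lying to the right of the last zero of $\psi_+(\lambda,\cdot)$ and of $u_b(\lambda,\cdot)$ (if any), $$\psi_+(\lambda,x)\,\psi_+(\lambda,x_0)^{-1}=u_b(\lambda,x)\,u_b(\lambda,x_0)^{-1},$$ that is, $\psi_+(\lambda,\cdot)$ and $u_b(\lambda,\cdot)$, $\lambda<\lambda_b$, are constant multiples of each other. Here $\psi_-(\lambda,\cdot)$, $\psi_+(\lambda,\cdot)$ are the Weyl--Titchmarsh solutions of $\ell u=\lambda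 u$ at $a$, respectively $b$, and $u_a(\lambda,\cdot)$, $u_b(\lambda,\cdot)$ are the principal solutions of $\ell u=\lambda u$ at $a$, respectively $b$.
   Context: Solutions of $\ell u=zu$, $z\in\mathbb{C}$, are understood in the distributional sense: $u$ and $pu'$ are locally absolutely continuous on $(a,b)$ and $-(pu')'+qu=zru$ a.e. on $(a,b)$. Nonoscillatory: fix $c\in(a,b)$. $\ell$ is nonoscillatory near $a$ (resp. $b$) for some $\lambda\in\mathbb{R}$ if every (real-valued, nontrivial) solution of $\ell u=\lambda u$ has finitely many zeros in $(a,c)$ (resp. $(c,b)$). ''$\ell$ is nonoscillatory at $a$ (resp. $b$)'' means that this holds for some $\lambda\in\mathbb{R}$. Limit point case: $\ell$ is in the limit point case at $a$ (resp. $b$) if, for $z\in\mathbb{C}\setminus\mathbb{R}$ and for some (hence for all) $c\in(a,b)$, there exists a unique (up to constant, generally $z$-dependent, multiples) nontrivial solution $\psi_-(z,\cdot)$ (resp. $\psi_+(z,\cdot)$) of $\ell u=zu$ with $\psi_-(z,\cdot)\in L^2((a,c);r\,dx)$ (resp. $\psi_+(z,\cdot)\in L^2((c,b);r\,dx)$). Weyl--Titchmarsh solutions for real spectral parameter: if $\ell$ is in the limit point case at $a$ (resp. $b$) and nonoscillatory near $a$ (resp. $b$) for some $\mu_a\in\mathbb{R}$ (resp. $\mu_b\in\mathbb{R}$), then $\psi_-(z,\cdot)$ (resp. $\psi_+(z,\cdot)$), suitably normalized by $z$-dependent constants, extends analytically in $z$ from $\mathbb{C}\setminus\mathbb{R}$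 to $\mathbb{C}\setminus[\mu_a,\infty)$ (resp. $\mathbb{C}\setminus[\mu_b,\infty)$). For real $\lambda<\mu_a$ (resp. $\lambda<\mu_b$), $\psi_-(\lambda,\cdot)$ (resp. $\psi_+(\lambda,\cdot)$) denotes this extension; it is a nontrivial solution of $\ell u=\lambda u$ that lies in $L^2((a,c);r\,dx)$ (resp. $L^2((c,b);r\,dx)$), $c\in(a,b)$. Principal solutions: for $\lambda\in\mathbb{R}$, a real-valued solution $u_a(\lambda,\cdot)$ (resp. $u_b(\lambda,\cdot)$) of $\ell u=\lambda u$ is called principal at $a$ (resp. $b$) if for some $c\in(a,b)$ it does not vanish on $(a,c]$ (resp. $[c,b)$) and $$\int_a^c dx\,p(x)^{-1}u_a(\lambda,x)^{-2}=\infty\quad\Big(\text{resp. }\int_c^b dx\,p(x)^{-1}u_b(\lambda,x)^{-2}=\infty\Big).$$ Principal solutions are unique up to constant (possibly $\lambda$-dependent) multiples. *)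

(* Defs.v *)
From HB Require Import structures.
From mathcomp Require Import all_boot all_order all_algebra.
From mathcomp Require Import all_classical all_reals all_analysis.
From mathcomp Require Import complex.

Set Implicit Arguments.
Unset Strict Implicit.
Unset Printing Implicit Defensive.

Import Order.TTheory GRing.Theory Num.Theory.
Import numFieldNormedType.Exports.

Local Open Scope classical_set_scope.
Local Open Scope ring_scope.
Local Open Scope complex_scope.

(* Measurability and integration are with respect to the Lebesgue sigma-algebra,
   not just the Borel one, hence the completed measure throughout. *)
Notation leb := (@completed_lebesgue_measure _).

Definition lebesgue_measurable (R : realType) (D : set R) (f : R -> R) : Prop :=
  measurable_fun
    (D : set (caratheodory_type (wlength (R := R) idfun)^*%mu))
    (f : _ -> measurableTypeR R).

Definition L1loc (R : realType) (D : set R) (f : R -> R) : Prop :=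
  forall K : set R, compact K -> K `<=` D -> leb.-integrable K (EFin \o f).

Definition ooitv (R : realType) (a b : \bar R) : set R :=
  [set x : R | (a < x%:E)%E /\ (x%:E < b)%E].

Definition abs_continuous (R : realType) (c d : R) (f : R -> R) : Prop :=
  forall e : R, 0 < e -> exists2 delta : R, 0 < delta &
    forall (n : nat) (s t : 'I_n -> R),
      (forall i, [/\ c <= s i, s i <= t i & t i <= d]) ->
      trivIset [set: 'I_n] (fun i => [set x : R | s i < x < t i]) ->
      \sum_(i < n) (t i - s i) < delta ->
      \sum_(i < n) `|f (t i) - f (s i)| < e.

Definition ACloc (R : realType) (a b : \bar R) (f : R -> R) : Prop :=
  forall c d : R, ooitv a b c -> ooitv a b d -> abs_continuous c d f.

(* Functions of a real variable with values in R[i] are treated through their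
   real and imaginary parts. *)
Definition cACloc (R : realType) (a b : \bar R) (f : R -> R[i]) : Prop :=
  ACloc a b (fun x => complex.Re (f x)) /\ ACloc a b (fun x => complex.Im (f x)).

Definition cderivable (R : realType) (f : R -> R[i]) (x : R) : Prop :=
  derivable (fun y => complex.Re (f y)) x 1 /\
  derivable (fun y => complex.Im (f y)) x 1.

Definition cderive (R : realType) (f : R -> R[i]) (x : R) : R[i] :=
  derive1 (fun y => complex.Re (f y)) x +i* derive1 (fun y => complex.Im (f y)) x.

(* u solves l u = z u on (a, b).  As u' exists only almost everywhere, the
   requirement that p u' is locally absolutely continuous means that p u'
   agrees almost everywhere with a locally absolutely continuous w. *)
Definition solution (R : realType) (a b : \bar R) (p q r : R -> R) (z : R[i])
    (u : R -> R[i]) : Prop :=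
  cACloc a b u /\
  exists w : R -> R[i],
    [/\ cACloc a b w,
        {ae leb, forall x : R, ooitv a b x ->
           cderivable u x /\ w x = (p x)%:C * cderive u x} &
        {ae leb, forall x : R, ooitv a b x ->
           cderivable w x /\
           - cderive w x + (q x)%:C * u x = z * (r x)%:C * u x}].

Definition real_solution (R : realType) (a b : \bar R) (p q r : R -> R)
    (lambda : R) (u : R -> R) : Prop :=
  solution a b p q r lambda%:C (fun x => (u x)%:C).

Definition nontrivial (R : realType) (K : nmodType) (a b : \bar R)
    (u : R -> K) : Prop :=
  exists2 x : R, ooitv a b x & u x != 0.

Inductive endpoint : Set := left_end | right_end.

(* (a, c) for the left endpoint, (c, b) for the right one *)
Definition near_end (R : realType) (a b : \bar R) (e : endpoint) (c : R) :
    set R :=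
  match e with
  | left_end => ooitv a c%:E
  | right_end => ooitv c%:E b
  end.

Definition L2 (R : realType) (r : R -> R) (J : set R) (u : R -> R[i]) : Prop :=
  leb.-integrable J (fun x : R => (ComplexField.Normc.normc (u x) ^+ 2 * r x)%:E).

Definition nonoscillatory_near (R : realType) (a b : \bar R) (p q r : R -> R)
    (e : endpoint) (lambda : R) : Prop :=
  exists2 c : R, ooitv a b c &
    forall u : R -> R, real_solution a b p q r lambda u -> nontrivial a b u ->
      finite_set [set x : R | near_end a b e c x /\ u x = 0].

Definition nonoscillatory (R : realType) (a b : \bar R) (p q r : R -> R)
    (e : endpoint) : Prop :=
  exists lambda : R, nonoscillatory_near a b p q r e lambda.

Definition limit_point_case (R : realType) (a b : \bar R) (p q r : R -> R)
    (e : endpoint) : Prop :=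
  forall z : R[i], complex.Im z != 0 ->
    exists2 c : R, ooitv a b c &
      exists psi : R -> R[i],
        [/\ solution a b p q r z psi, nontrivial a b psi,
            L2 r (near_end a b e c) psi &
            forall phi : R -> R[i],
              solution a b p q r z phi -> nontrivial a b phi ->
              L2 r (near_end a b e c) phi ->
              exists k : R[i], forall x : R, ooitv a b x -> phi x = k * psi x].

Definition L2_solution (R : realType) (a b : \bar R) (p q r : R -> R)
    (e : endpoint) (z : R[i]) (u : R -> R[i]) : Prop :=
  [/\ solution a b p q r z u, nontrivial a b u &
      exists2 c : R, ooitv a b c & L2 r (near_end a b e c) u].

(* Psi z is, for nonreal z, the Weyl solution of l u = z u, normalized so that
   it extends analytically in z to C \ [mu, oo); analyticity on this open set is
   complex differentiability, 'derivable' being taken over the field R[i]. *)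
Definition weyl_family (R : realType) (a b : \bar R) (p q r : R -> R)
    (e : endpoint) (mu : R) (Psi : R[i] -> R -> R[i]) : Prop :=
  [/\ forall z : R[i], complex.Im z != 0 -> L2_solution a b p q r e z (Psi z),
      forall x : R, ooitv a b x ->
        forall z : R[i], ~ (complex.Im z = 0 /\ mu <= complex.Re z) ->
          derivable (fun y : R[i]^o => Psi y x : R[i]^o) z 1 &
      forall lambda : R, lambda < mu ->
        L2_solution a b p q r e lambda%:C (Psi lambda%:C)].

(* psi is the Weyl-Titchmarsh solution, for the real spectral parameter lambda:
   the value at lambda of an analytic extension as above, for some mu > lambda
   at which l is nonoscillatory near the endpoint. *)
Definition weyl_titchmarsh (R : realType) (a b : \bar R) (p q r : R -> R)
    (e : endpoint) (lambda : R) (psi : R -> R[i]) : Prop :=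
  exists (mu : R) (Psi : R[i] -> R -> R[i]),
    [/\ nonoscillatory_near a b p q r e mu, lambda < mu,
        weyl_family a b p q r e mu Psi & psi = Psi lambda%:C].

Definition principal (R : realType) (a b : \bar R) (p q r : R -> R)
    (e : endpoint) (lambda : R) (u : R -> R) : Prop :=
  real_solution a b p q r lambda u /\
  exists2 c : R, ooitv a b c &
    (forall x : R, near_end a b e c x \/ x = c -> u x != 0) /\
    (\int[leb]_(x in near_end a b e c) ((p x)^-1 * (u x) ^- 2)%:E = +oo)%E.

(* Main.v *)
Require Import Defs.
From HB Require Import structures.
From mathcomp Require Import all_boot all_order all_algebra.
From mathcomp Require Import all_classical all_reals all_analysis.
From mathcomp Require Import measurable_realfun.
From mathcomp Require Import complex ring lra.

(** Fix a real lambda, let psi be a solution at lambda that is square integrable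
    near the endpoint, and let u be principal there.  As lambda is real, the real
    and imaginary parts of psi are solutions as well, so it suffices that a real
    square integrable solution s is a multiple of u.  Write w_s = p s' and
    w_u = p u', and let W = u w_s - w_u s be the (constant) Wronskian.

    If W <> 0, then (s / u)' = W / (p u^2), and the integral of 1 / (p u^2)
    diverges at the endpoint because u is principal.  Hence |s / u| tends to
    infinity, |u| <= |s| near the endpoint ([principal_dominated]), and u is
    square integrable together with s.  This contradicts the limit point case
    ([limit_point_wronskian_eq0]), by a form of Weyl's alternative: at
    z = lambda + i take the square integrable solution psi_z; a formula in the
    style of Rofe-Beketov produces a solution phi independent of psi_z by a single
    integration ([second_solution]), so that no existence theorem for the
    differential equation is called for.  Variation of parameters expresses phi
    as alpha u + beta s, and Gronwall's inequality bounds |alpha|^2 + |beta|^2 by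
    the exponential of the integral of r (u^2 + s^2) / |W|, which is finite near
    the endpoint ([solution_bound]).  So phi is square integrable and not a
    multiple of psi_z.

    Hence W = 0, and s - (s(c) / u(c)) u, whose Cauchy data at c vanish, is zero
    by uniqueness ([proportional]).

    Solutions are only locally absolutely continuous, so the differential
    identities above hold almost everywhere.  They are exploited through two
    facts: a locally absolutely continuous function with a.e. nonnegative
    derivative is nondecreasing ([ae_deriv_ge0_le]), and a locally integrable
    function has a locally absolutely continuous primitive
    ([L1loc_primitive]). *)

Set Implicit Arguments.
Unset Strict Implicit.
Unset Printing Implicit Defensive.

Import Order.TTheory GRing.Theory Num.Theory.
Import numFieldNormedType.Exports.

Local Open Scope classical_set_scope.
Local Open Scope ring_scope.

Local Notation lebT R := (caratheodory_type (wlength (R := R) idfun)^*%mu).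

(** * Open intervals and their exhaustion by segments *)

Lemma ooitv_between (R : realType) (a b : \bar R) (s t x : R) :
  ooitv a b s -> ooitv a b t -> s <= x <= t -> ooitv a b x.
Proof.
move=> [as_ _] [_ tb] /andP[sx xt]; split.
  by apply: lt_le_trans as_ _; rewrite lee_fin.
by apply: le_lt_trans tb; rewrite lee_fin.
Qed.

Lemma open_ooitv (R : realType) (a b : \bar R) : open (ooitv a b).
Proof. by apply: openI; [exact: open_ereal_gt|exact: open_ereal_lt]. Qed.

(** The endpoint may be infinite, so the sequence is [a + (c - a) / (n + 2)] or
    [c - n - 1]; the right endpoint reduces to this case by reflection. *)
Lemma approx_left (R : realType) (a : \bar R) (c : R) : (a < c%:E)%E ->
  exists x : nat -> R, [/\ forall n, (a < (x n)%:E)%E /\ x n < c,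
    forall m n, (m <= n)%N -> x n <= x m &
    forall t : R, (a < t%:E)%E -> exists n, x n < t].
Proof.
case: a => [a| |] //=.
- rewrite lte_fin => ac; exists (fun n => a + (c - a) / n.+2%:R).
  have ca : 0 < c - a by rewrite subr_gt0.
  split.
  + move=> n; rewrite lte_fin ltrDl divr_gt0//; split=> //.
    rewrite -ltrBrDl ltr_pdivrMr// ltr_pMr// ltr1n//.
  + move=> m n mn; rewrite lerD2l ler_pM2l// lef_pV2 ?posrE// ler_nat.
    by rewrite !ltnS.
  + move=> t; rewrite lte_fin => at_.
    have ta : 0 < t - a by rewrite subr_gt0.
    have [n hn] : exists n, (c - a) / (t - a) < n.+2%:R.
      exists (Num.truncn ((c - a) / (t - a))).
      apply: (lt_le_trans (truncnS_gt _)); rewrite ler_nat; exact: leqnSn.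
    exists n; rewrite -ltrBrDl ltr_pdivrMr//.
    by move: hn; rewrite ltr_pdivrMr// mulrC.
- move=> _; exists (fun n => c - n.+1%:R); split.
  + by move=> n; rewrite ltNyr ltrBlDr ltrDl.
  + by move=> m n mn; rewrite lerD2l lerN2 ler_nat ltnS.
  + move=> t _; exists (Num.truncn (c - t)).
    rewrite ltrBlDr -ltrBlDl; exact: truncnS_gt.
Qed.

Lemma approx_right (R : realType) (b : \bar R) (c : R) : (c%:E < b)%E ->
  exists y : nat -> R, [/\ forall n, ((y n)%:E < b)%E /\ c < y n,
    forall m n, (m <= n)%N -> y m <= y n &
    forall t : R, (t%:E < b)%E -> exists n, t < y n].
Proof.
move=> cb; have : (- b < (- c)%:E)%E by rewrite EFinN lteN2.
move=> /approx_left[x [x1 x2 x3]]; exists (fun n => - x n); split.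
- move=> n; have [h1 h2] := x1 n.
  by rewrite EFinN lteNl h1 ltrNr.
- by move=> m n /x2; rewrite lerN2.
- move=> t tb; have /x3[n hn] : (- b < (- t)%:E)%E by rewrite EFinN lteN2.
  by exists n; rewrite ltrNr.
Qed.

(** Local integrability speaks of segments only; exhaustion transports its consequences
    to the whole interval. *)
Lemma ooitv_exhaust (R : realType) (a b : \bar R) (c : R) : ooitv a b c ->
  exists x y : nat -> R,
  [/\ forall n, [/\ ooitv a b (x n), ooitv a b (y n), x n < c & c < y n],
      forall m n, (m <= n)%N -> `[x m, y m] `<=` `[x n, y n],
      forall t, ooitv a b t -> exists n, x n < t < y n &
      ooitv a b = \bigcup_n `[x n, y n]%classic].
Proof.
move=> [ac cb]; have [x [x1 x2 x3]] := approx_left ac.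
have [y [y1 y2 y3]] := approx_right cb.
have inside n : [/\ ooitv a b (x n), ooitv a b (y n), x n < c & c < y n].
  have [axn xnc] := x1 n; have [ynb cyn] := y1 n; split=> //; split => //.
    by apply: lt_trans cb; rewrite lte_fin.
  by apply: lt_trans ac _; rewrite lte_fin.
have cover t : ooitv a b t -> exists n, x n < t < y n.
  move=> [/x3[m xmt] /y3[n tyn]]; exists (maxn m n).
  rewrite (le_lt_trans _ xmt) ?x2 ?leq_maxl//=.
  by rewrite (lt_le_trans tyn)// y2// leq_maxr.
exists x, y; split=> //.
- move=> m n mn t /=; rewrite !in_itv/= => /andP[xt ty].
  by rewrite (le_trans (x2 _ _ mn))//= (le_trans ty)// y2.
- apply/seteqP; split=> t.
    by move=> /cover[n /andP[xt ty]]; exists n => //=; rewrite in_itv/= !ltW.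
  by move=> [n _]/=; rewrite in_itv/=; have [? ? _ _] := inside n; exact: ooitv_between.
Qed.

(** * Local absolute continuity *)

(** The one estimate behind all closure properties below: sums, products, inverses
    and exponentials have increments dominated by those of their arguments, with a
    constant coming from boundedness on the segment. *)
Lemma abs_continuous_dom (R : realType) (c d M : R) (f g h : R -> R) :
  abs_continuous c d f -> abs_continuous c d g ->
  (forall s t, c <= s -> s <= t -> t <= d ->
    `|h t - h s| <= M * (`|f t - f s| + `|g t - g s|)) ->
  abs_continuous c d h.
Proof.
move=> acf acg H e e0.
pose M' := Num.max M 1.
have M'0 : 0 < M' by rewrite lt_max ltr01 orbT.
have e'0 : 0 < e / M' / 2 by rewrite !divr_gt0.
have [d1 d10 hf] := acf _ e'0.
have [d2 d20 hg] := acg _ e'0.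
exists (Num.min d1 d2); first by rewrite lt_min d10.
move=> n s t st tI; rewrite lt_min => /andP[l1 l2].
have {}hf := hf n s t st tI l1.
have {}hg := hg n s t st tI l2.
apply: (@le_lt_trans _ _ (\sum_(i < n) M' * (`|f (t i) - f (s i)| + `|g (t i) - g (s i)|))).
  apply: ler_sum => i _; have [h1 h2 h3] := st i.
  apply: (le_trans (H _ _ h1 h2 h3)); rewrite ler_wpM2r// ?addr_ge0//.
  by rewrite le_max lexx.
rewrite -mulr_sumr big_split/= mulrC -ltr_pdivlMr//.
by rewrite (splitr (e / M')) ltrD.
Qed.

Lemma abs_continuous_cst (R : realType) (c d k : R) : abs_continuous c d (fun=> k).
Proof.
move=> e e0; exists 1 => // n s t _ _ _.
by rewrite big1// => i _; rewrite subrr normr0.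
Qed.

Lemma ACloc_continuous (R : realType) (a b : \bar R) (f : R -> R) (x : R) :
  ACloc a b f -> ooitv a b x -> {for x, continuous f}.
Proof.
move=> acf xab.
have [e /= e0 be] : nbhs x (ooitv a b) by apply: open_nbhs_nbhs; split=> //; exact: open_ooitv.
have inab y : `|y - x| <= e / 2 -> ooitv a b y.
  move=> yx; apply: be => /=; rewrite distrC (le_lt_trans yx)// ltr_pdivrMr// ltr_pMr// ltr1n//.
have hc : ooitv a b (x - e / 2).
  by apply: inab; rewrite addrAC subrr add0r normrN ger0_norm// divr_ge0// ltW.
have hd : ooitv a b (x + e / 2).
  by apply: inab; rewrite addrAC subrr add0r ger0_norm// divr_ge0// ltW.
apply/cvgrPdist_lt => eps eps0.
have [de de0 H] := acf _ _ hc hd _ eps0.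
near=> y.
have yx : `|x - y| < Num.min de (e / 2).
  by near: y; apply: cvgr_dist_lt; [exact: cvg_id|rewrite lt_min de0 divr_gt0].
move: yx; rewrite lt_min => /andP[y1 y2].
have := H 1%N (fun=> Num.min x y) (fun=> Num.max x y).
rewrite !big_ord1; move: y1 y2; rewrite !ltr_norml => /andP[y1 y1'] /andP[y2 y2'].
have tI : trivIset [set: 'I_1] (fun=> [set z | Num.min x y < z < Num.max x y]).
  by move=> i j _ _ _; rewrite (ord1 i) (ord1 j).
rewrite -!ltr_norml; move: tI; have [xy|yx] := leP x y => tI h.
  by rewrite distrC; apply: h => // [_|]; [split|]; clear -y1 y1' y2 y2' xy; lra.
by apply: h => // _; split; clear -y1 y1' y2 y2' yx; lra.
Unshelve. all: by end_near. Qed.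

Lemma continuous_itv_bounded (R : realType) (c d : R) (f : R -> R) :
  (forall x, c <= x <= d -> {for x, continuous f}) ->
  exists2 M, 0 < M & forall x, c <= x <= d -> `|f x| <= M.
Proof.
move=> cf.
have : compact (f @` `[c, d]).
  apply: continuous_compact; last exact: segment_compact.
  apply: continuous_in_subspaceT => x; rewrite inE /= in_itv/= => /cf; exact.
move=> /compact_bounded[M0 [_ HM]]; exists (Num.max (M0 + 1) 1).
  by rewrite lt_max ltr01 orbT.
move=> x xcd; apply: HM; last by exists x => //; rewrite /= in_itv.
by rewrite lt_max ltrDl ltr01.
Qed.

Lemma ACloc_bounded (R : realType) (a b : \bar R) (f : R -> R) (c d : R) :
  ACloc a b f -> ooitv a b c -> ooitv a b d ->
  exists2 M, 0 < M & forall x, c <= x <= d -> `|f x| <= M.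
Proof.
move=> acf ac bd; apply: continuous_itv_bounded => x xcd.
by apply: ACloc_continuous acf _; exact: ooitv_between xcd.
Qed.

Lemma ACloc_cst (R : realType) (a b : \bar R) (k : R) : ACloc a b (fun=> k).
Proof. by move=> c d _ _; exact: abs_continuous_cst. Qed.

Lemma ACloc_add (R : realType) (a b : \bar R) (f g : R -> R) :
  ACloc a b f -> ACloc a b g -> ACloc a b (fun x => f x + g x).
Proof.
move=> acf acg c d hc hd.
apply: (abs_continuous_dom (M := 1) (acf _ _ hc hd) (acg _ _ hc hd)).
move=> s t _ _ _; rewrite mul1r (le_trans _ (ler_normD _ _))//.
by rewrite opprD addrACA.
Qed.

Lemma ACloc_opp (R : realType) (a b : \bar R) (f : R -> R) :
  ACloc a b f -> ACloc a b (fun x => - f x).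
Proof.
move=> acf c d hc hd.
apply: (abs_continuous_dom (M := 1) (acf _ _ hc hd) (acf _ _ hc hd)).
move=> s t _ _ _; rewrite mul1r -opprD normrN lerDl//.
Qed.

Lemma ACloc_mul (R : realType) (a b : \bar R) (f g : R -> R) :
  ACloc a b f -> ACloc a b g -> ACloc a b (fun x => f x * g x).
Proof.
move=> acf acg c d hc hd.
have [M M0 fM] := ACloc_bounded acf hc hd.
have [N N0 gN] := ACloc_bounded acg hc hd.
apply: (abs_continuous_dom (M := M + N) (acf _ _ hc hd) (acg _ _ hc hd)).
move=> s t cs st td.
have -> : f t * g t - f s * g s = f t * (g t - g s) + (f t - f s) * g s by ring.
rewrite (le_trans (ler_normD _ _))// !normrM.
have h1 : `|f t| <= M by apply: fM; rewrite td (le_trans cs).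
have h2 : `|g s| <= N by apply: gN; rewrite cs (le_trans st).
have := normr_ge0 (g t - g s); have := normr_ge0 (f t - f s).
have := normr_ge0 (f t); have := normr_ge0 (g s).
by nra.
Qed.

Lemma ACloc_inv (R : realType) (a b : \bar R) (f : R -> R) :
  ACloc a b f -> (forall x, ooitv a b x -> f x != 0) ->
  ACloc a b (fun x => (f x)^-1).
Proof.
move=> acf f0 c d hc hd.
have in_cd x : c <= x <= d -> ooitv a b x by exact: ooitv_between.
have [M M0 fM] : exists2 M, 0 < M & forall x, c <= x <= d -> `|(f x)^-1| <= M.
  apply: continuous_itv_bounded => x /in_cd xab.
  by apply: cvgV; [exact: f0|exact: ACloc_continuous acf xab].
apply: (abs_continuous_dom (M := M * M) (acf _ _ hc hd) (acf _ _ hc hd)).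
move=> s t cs st td.
have h1 : c <= t <= d by rewrite td (le_trans cs).
have h2 : c <= s <= d by rewrite cs (le_trans st).
have ft0 := f0 _ (in_cd _ h1); have fs0 := f0 _ (in_cd _ h2).
have -> : (f t)^-1 - (f s)^-1 = (f t)^-1 * (f s)^-1 * - (f t - f s).
  by field; rewrite fs0.
rewrite !normrM normrN ler_pM// ?mulr_ge0//.
  by rewrite ler_pM// fM.
by rewrite lerDl.
Qed.

Lemma ACloc_expR (R : realType) (a b : \bar R) (f : R -> R) :
  ACloc a b f -> ACloc a b (fun x => expR (f x)).
Proof.
move=> acf c d hc hd.
have [M M0 fM] := ACloc_bounded acf hc hd.
apply: (abs_continuous_dom (M := expR M) (acf _ _ hc hd) (acf _ _ hc hd)).
have key x y : x <= y -> y <= M -> `|expR y - expR x| <= expR M * (`|y - x| + `|y - x|).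
  move=> xy yM; rewrite !ger0_norm ?subr_ge0 ?ler_expR//.
  have := expR_ge1Dx (x - y); rewrite expRB => h.
  have y0 : 0 < expR y := expR_gt0 y.
  have yM' : expR y <= expR M by rewrite ler_expR.
  move: h; rewrite ler_pdivlMr// => h; nra.
move=> s t cs st td.
have := fM s; rewrite cs (le_trans st) => // /(_ isT); rewrite ler_norml => /andP[_ fs].
have := fM t; rewrite td (le_trans cs) => // /(_ isT); rewrite ler_norml => /andP[_ ft].
have [fst|/ltW fts] := leP (f s) (f t); first exact: key.
by rewrite distrC (distrC (f t)) key.
Qed.

(** Absolute continuity is bundled with an a.e. derivative so that identities between
    solutions become pointwise algebra, discharged by [ac_deriv_eq], followed by one
    appeal to [ae_deriv0_const] or [ae_deriv_ge0_le]. *)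
Definition ac_deriv (R : realType) (a b : \bar R) (F f : R -> R) : Prop :=
  ACloc a b F /\ {ae leb, forall x : R, ooitv a b x -> is_derive x (1 : R) F (f x)}.

#[local] Instance leb_filter (R : realType) :
  Filter (nbhs (almost_everywhere (leb : set _ -> \bar R))).
Proof. exact: ae_filter_ringOfSetsType. Qed.

Lemma ac_deriv_eq (R : realType) (a b : \bar R) (F f g : R -> R) :
  ac_deriv a b F f -> {ae leb, forall x : R, ooitv a b x -> f x = g x} ->
  ac_deriv a b F g.
Proof.
move=> [acF dF] fg; split=> //; apply: filterS2 dF fg => x h1 h2 xab.
by rewrite -h2//; exact: h1.
Qed.

Lemma ac_deriv_cst (R : realType) (a b : \bar R) (k : R) :
  ac_deriv a b (fun=> k) (fun=> 0).
Proof.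
split; first exact: ACloc_cst.
by apply: aeW => x _; exact: is_derive_cst.
Qed.

Lemma ac_deriv_add (R : realType) (a b : \bar R) (F G f g : R -> R) :
  ac_deriv a b F f -> ac_deriv a b G g ->
  ac_deriv a b (fun x => F x + G x) (fun x => f x + g x).
Proof.
move=> [aF dF] [aG dG]; split; first exact: ACloc_add.
apply: filterS2 dF dG => x h1 h2 xab.
by apply: is_deriveD; [exact: h1|exact: h2].
Qed.

Lemma ac_deriv_opp (R : realType) (a b : \bar R) (F f : R -> R) :
  ac_deriv a b F f -> ac_deriv a b (fun x => - F x) (fun x => - f x).
Proof.
move=> [aF dF]; split; first exact: ACloc_opp.
by apply: filterS dF => x h1 xab; apply: is_deriveN; exact: h1.
Qed.

Lemma ac_deriv_mul (R : realType) (a b : \bar R) (F G f g : R -> R) :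
  ac_deriv a b F f -> ac_deriv a b G g ->
  ac_deriv a b (fun x => F x * G x) (fun x => f x * G x + F x * g x).
Proof.
move=> [aF dF] [aG dG]; split; first exact: ACloc_mul.
apply: filterS2 dF dG => x h1 h2 xab.
apply: (is_derive_eq (is_deriveM (h1 xab) (h2 xab))).
by rewrite /GRing.scale/=; ring.
Qed.

Lemma ac_deriv_inv (R : realType) (a b : \bar R) (F f : R -> R) :
  ac_deriv a b F f -> (forall x, ooitv a b x -> F x != 0) ->
  ac_deriv a b (fun x => (F x)^-1) (fun x => - f x / F x ^+ 2).
Proof.
move=> [aF dF] F0; split; first exact: ACloc_inv.
apply: filterS dF => x h1 xab.
have {}h1 := h1 xab; have Fx0 := F0 _ xab.
apply: (is_derive_eq (is_deriveV Fx0 h1)).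
by rewrite /GRing.scale/=; field.
Qed.

Lemma ac_deriv_expR (R : realType) (a b : \bar R) (F f : R -> R) :
  ac_deriv a b F f -> ac_deriv a b (fun x => expR (F x)) (fun x => expR (F x) * f x).
Proof.
move=> [aF dF]; split; first exact: ACloc_expR.
apply: filterS dF => x h1 xab.
have {}h1 := h1 xab.
by apply: (is_derive_eq (is_derive1_comp _ _)).
Qed.

(** * Absolutely continuous functions with nonnegative derivative *)

(** A set measurable for the completed measure is a Borel set up to a subset of a
    Borel null set, so both measures have the same null sets. *)
Lemma leb_negligible (R : realType) (N : set R) :
  (leb : set _ -> \bar R).-negligible N ->
  (lebesgue_measure : set (measurableTypeR R) -> \bar R).-negligible N.
Proof.
move=> [/= A [mA A0 NA]].
have : (wlength (R := R) idfun)^*%mu.-cara.-measurable A by exact: mA.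
rewrite -completed_caratheodory_measurable g_sigma_completed_algebra_genE.
move=> [/= B mB [N' [B' [/= mB' B'0 N'B']]] BN'].
exists (B `|` B'); split; first exact: measurableU.
  apply/eqP; rewrite -measure_le0.
  apply: le_trans (measureU2 _ mB mB') _.
  rewrite [X in (_ + X)%E](B'0 : _ = 0%E) adde0 -A0.
  by apply: le_outer_measure => x Bx; rewrite -BN'; left.
move=> x /NA; rewrite -BN' => -[|/N'B']; [by left|by right].
Qed.

Lemma leb_negligible_of (R : realType) (N : set R) :
  (lebesgue_measure : set (measurableTypeR R) -> \bar R).-negligible N ->
  (leb : set _ -> \bar R).-negligible N.
Proof.
move=> [/= B [mB B0 NB]]; exists B; split => //=.
exact: sub_caratheodory.
Qed.

Lemma negligible_open_cover (R : realType) (N : set R) (e : R) : 0 < e ->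
  (leb : set _ -> \bar R).-negligible N ->
  exists U : set R, [/\ open U, N `<=` U & (lebesgue_measure U < e%:E)%E].
Proof.
move=> e0 /leb_negligible[/= B [mB B0 NB]].
have B0' : lebesgue_measure B = 0%E :> \bar R by [].
have [|U [oU BU Ue]] := lebesgue_regularity_outer mB _ e0; first by rewrite [X in (X < _)%E]B0'.
exists U; split => //; first exact: subset_trans BU.
rewrite -(setDUK BU) (le_lt_trans (measureU2 _ _ _))//.
  by apply: measurableD => //; exact: open_measurable.
by rewrite [X in (X + _)%E]B0' add0e.
Qed.

(** The encoding of a tagged partition of [[c, y]], built from left to right.  The list
    keeps only the steps inside the exceptional set [U], as these alone are charged to
    absolute continuity. *)
Inductive tagged_chain (R : realType) (F : R -> R) (e c : R) (U : set R) :
    R -> seq (R * R) -> Prop :=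
| chain_nil : tagged_chain F e c U c [::]
| chain_slope x y l : tagged_chain F e c U x l -> x < y ->
    - (e * (y - x)) <= F y - F x -> tagged_chain F e c U y l
| chain_cover x y l : tagged_chain F e c U x l -> x < y ->
    `[x, y] `<=` U -> tagged_chain F e c U y ((x, y) :: l).

(** The recorded intervals do not overlap and lie in [U], so their total length is at
    most the measure of [U]; tracking that measure inside [[c, y]] makes this an
    induction on the chain.  The other steps cost at most [e * (y - c)] in total. *)
Lemma tagged_chainP (R : realType) (F : R -> R) (e c : R) (U : set R) y l :
  0 < e -> open U -> tagged_chain F e c U y l ->
  [/\ c <= y,
      - (e * (y - c)) - \sum_(i <- l) `|F i.2 - F i.1| <= F y - F c,
      ((\sum_(i <- l) (i.2 - i.1))%:E <= lebesgue_measure (U `&` `[c, y]%classic))%E,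
      all (fun i => [&& c <= i.1, i.1 <= i.2 & i.2 <= y]) l &
      pairwise (fun i j => j.2 <= i.1) l].
Proof.
move=> e0 oU; have mU : measurable (U : set (measurableTypeR R)) by exact: open_measurable.
have mI x z : measurable ((U `&` `[x, z]%classic) : set (measurableTypeR R)).
  exact: measurableI.
elim=> {y l} [|x y l _ [cx IHF IHm IHa IHp] xy Fxy|x y l _ [cx IHF IHm IHa IHp] xy xyU].
- by split; rewrite ?big_nil// ?subrr ?mulr0 ?oppr0 ?subr0 ?measure_ge0.
- split=> //; [lra|lra| |].
  + apply: (le_trans IHm); apply: le_measure; rewrite ?inE//.
    apply: setIS => t /=; rewrite !in_itv/= => /andP[-> tx] /=.
    by rewrite (le_trans tx)// ltW.
  + by apply: sub_all IHa => -[s t] /= /and3P[-> -> h] /=; rewrite (le_trans h)// ltW.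
- have cy : c <= y by lra.
  split=> //; rewrite ?big_cons /=.
  + have h : - `|F y - F x| <= F y - F x by rewrite lerNl -normrN ler_norm.
    have h2 : 0 < e * (y - x) by rewrite mulr_gt0// subr_gt0.
    lra.
  + have mx : measurable ((U `&` `]x, y]%classic) : set (measurableTypeR R)).
      exact: measurableI.
    have -> : U `&` `[c, y]%classic = (U `&` `[c, x]%classic) `|` (U `&` `]x, y]%classic).
      rewrite -setIUr; congr (_ `&` _); apply/seteqP; split=> t /=; rewrite !in_itv/=.
        by move=> /andP[-> ->]; have [] := leP t x; [left|right].
      by move=> [/andP[-> tx]|/andP[xt ->]]/=; lra.
    rewrite measureU//; last first.
      apply/seteqP; split=> t //= -[[_ +] [_]]; rewrite !in_itv/=; lra.
    rewrite EFinD addeC leeD//.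
    have -> : U `&` `]x, y]%classic = `]x, y]%classic.
      apply/seteqP; split=> t /= [] // ; rewrite in_itv/= => h.
      by split=> //; apply: xyU => /=; rewrite in_itv/=; lra.
    by rewrite [leRHS](lebesgue_measure_itv `]x, y]) /= lte_fin xy -EFinB.
  + rewrite cx lexx ltW//=.
    by apply: sub_all IHa => -[s t] /= /and3P[-> -> h] /=; rewrite (le_trans h)// ltW.
  + by rewrite IHp andbT; apply: sub_all IHa => -[s t] /= /and3P[].
Qed.

(** The supremum of the points of [[c, d]] reached by [S] is itself reached, and
    could be passed if it were smaller than [d].  It plays the role of Cousin's
    lemma on tagged partitions. *)
Lemma real_induction (R : realType) (S : set R) (c d : R) :
  S c -> c <= d ->
  (forall z, c <= z <= d -> exists2 eta : R, 0 < eta &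
     forall x y, z - eta < x -> x <= z -> z <= y -> y < z + eta -> x < y ->
       c <= x -> y <= d -> S x -> S y) ->
  S d.
Proof.
move=> Sc cd step; pose T := [set x | c <= x <= d /\ S x].
have Tc : T c by split; rewrite ?lexx.
have supT : has_sup T by split; [exists c|exists d => x [/andP[]]].
have cs : c <= sup T by exact: sup_upper_bound.
have sd : sup T <= d by apply: sup_le_ub => //; [exists c|move=> x [/andP[]]].
have [eta eta0 H] := step (sup T) (introT andP (conj cs sd)).
have [x Tx xs] := sup_adherent eta0 supT.
have xs' : x <= sup T by exact: sup_upper_bound.
have [/andP[cx xd] Sx] := Tx.
have Ss : S (sup T).
  move: xs'; rewrite le_eqVlt => /predU1P[<-//|xs'].
  by apply: (H x) => //; [exact: ltW|rewrite ltrDl].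
move: sd; rewrite le_eqVlt => /predU1P[<-//|sd].
pose y := Num.min d (sup T + eta / 2).
have yd : y <= d by rewrite ge_min lexx.
have sy : sup T < y by rewrite lt_min sd ltrDl divr_gt0.
have ye : y < sup T + eta.
  by rewrite gt_min; apply/orP; right; rewrite ltrD2l ltr_pdivrMr// ltr_pMr// ltr1n.
have Ty : T y.
  split; first by rewrite yd (le_trans cs)// ltW.
  by apply: (H (sup T)) => //; [rewrite gtrBl|exact: ltW].
have : y <= sup T by exact: sup_upper_bound.
by rewrite leNgt sy.
Qed.

Lemma derive_ge0_slope (R : realType) (F : R -> R) (z l e : R) :
  0 < e -> 0 <= l -> is_derive z (1 : R) F l -> exists2 eta : R, 0 < eta &
    forall x y, z - eta < x -> x <= z -> z <= y -> y < z + eta ->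
      - (e * (y - x)) <= F y - F x.
Proof.
move=> e0 l0 [/cvgrPdist_le/(_ e e0)/= H Dz].
rewrite (_ : lim _ = l) in H; last exact: Dz.
move: H => [eta /= eta0 H].
have {H} Hd h : `|h| < eta -> `|F (z + h) - F z - h * l| <= e * `|h|.
  move=> hlt; have [->|h0] := eqVneq h 0.
    by rewrite addr0 subrr mul0r subr0 normr0 mulr0.
  have := H h; rewrite /= sub0r normrN => /(_ hlt h0).
  rewrite /GRing.scale/= mulr1 (addrC h z) => {}H.
  have -> : F (z + h) - F z - h * l = - (l - h^-1 * (F (z + h) - F z)) * h.
    by field.
  by rewrite normrM normrN ler_wpM2r.
exists eta => // x y zx xz zy yz.
have h1 : `|F x - F z - (x - z) * l| <= e * (z - x).
  have := Hd (x - z); rewrite subrKC ler0_norm ?subr_le0// opprB; apply.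
  by clear -zx; lra.
have h2 : `|F y - F z - (y - z) * l| <= e * (y - z).
  have := Hd (y - z); rewrite subrKC ger0_norm ?subr_ge0//; apply.
  by clear -yz; lra.
move: h1 h2; rewrite !ler_norml => /andP[_ h1] /andP[h2 _].
have h3 : 0 <= (y - x) * l by rewrite mulr_ge0// subr_ge0 (le_trans xz).
by clear -h1 h2 h3; lra.
Qed.

(** Cover the null set where the derivative fails to exist or is negative by an open
    set [U] of small measure.  A chain from [c] to [d] whose steps have slope at least
    [- e] around good points and lie in [U] around bad ones exists by real induction;
    absolute continuity makes the total variation over the steps in [U] at most [e]. *)
Lemma ae_deriv_ge0_le (R : realType) (a b : \bar R) (F f : R -> R) (c d : R) :
  ac_deriv a b F f -> {ae leb, forall x : R, ooitv a b x -> 0 <= f x} ->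
  ooitv a b c -> ooitv a b d -> c <= d -> F c <= F d.
Proof.
move=> [acF dF] f0 hc hd cd.
suff H e : 0 < e -> - (e * (d - c)) - e <= F d - F c.
  rewrite -subr_ge0; apply/ler_addgt0Pr => e e0.
  have k0 : 0 < d - c + 1 by rewrite ltr_wpDl// subr_ge0.
  have := H (e / (d - c + 1)) (divr_gt0 e0 k0).
  have -> : - (e / (d - c + 1) * (d - c)) - e / (d - c + 1) = - e.
    by field; exact: lt0r_neq0.
  by rewrite -[- e]sub0r lerBlDr.
move=> e0.
have [de de0 acD] := acF _ _ hc hd _ e0.
pose good x := is_derive x (1 : R) F (f x) /\ 0 <= f x.
have [U [oU NU mU]] : exists U : set R, [/\ open U,
    ~` [set x | ooitv a b x -> good x] `<=` U & (lebesgue_measure U < de%:E)%E].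
  apply: negligible_open_cover => //.
  suff : {ae leb, forall x : R, ooitv a b x -> good x} by [].
  by apply: filterS2 dF f0 => x h1 h2 xab; split; [exact: h1|exact: h2].
have [l /(tagged_chainP e0 oU)[_ Hl lU la lp]] :
    exists l, tagged_chain F e c U d l.
  apply: (@real_induction _ [set x | exists l, tagged_chain F e c U x l] c) cd _.
    by exists [::]; exact: chain_nil.
  move=> z zcd; have zab := ooitv_between hc hd zcd.
  have [[dFz fz0]|ngz] := pselect (good z).
    have [eta eta0 H] := derive_ge0_slope e0 fz0 dFz.
    exists eta => // x y zx xz zy yz xy _ _ [l xl]; exists l.
    by apply: chain_slope xl xy _; exact: H.
  have Uz : U z by apply: NU => /= /(_ zab).
  have [eta /= eta0 hU] : nbhs z U by exact: open_nbhs_nbhs.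
  exists eta => // x y zx xz zy yz xy _ _ [l xl]; exists ((x, y) :: l).
  apply: chain_cover => // t /=; rewrite in_itv/= => /andP[xt ty].
  apply: hU => /=; rewrite ltr_norml.
  by apply/andP; split; [rewrite ltrNl opprB ltrBlDl|rewrite ltrBlDr -ltrBlDl];
    [exact: le_lt_trans yz|exact: lt_le_trans zx xt].
apply: le_trans Hl; rewrite lerD2l lerN2.
pose s (i : 'I_(size l)) := (nth (0, 0) l i).1.
pose t (i : 'I_(size l)) := (nth (0, 0) l i).2.
have := acD (size l) s t; rewrite /s /t.
rewrite -(big_mkord xpredT (fun i => (nth (0, 0) l i).2 - (nth (0, 0) l i).1)).
rewrite -(big_mkord xpredT (fun i => `|F (nth (0, 0) l i).2 - F (nth (0, 0) l i).1|)).
rewrite -(big_nth (0, 0) xpredT (fun i => i.2 - i.1)).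
rewrite -(big_nth (0, 0) xpredT (fun i => `|F i.2 - F i.1|)) => h; apply/ltW/h.
- by move=> i; apply/and3P; exact: (allP la _ (mem_nth _ _)).
- have disj (i j : 'I_(size l)) z : (i < j)%N ->
      z < (nth (0, 0) l j).2 -> (nth (0, 0) l i).1 < z -> False.
    move=> ij zj zi; have := pairwiseP (0, 0) lp => /(_ i j).
    rewrite !inE !ltn_ord ij => /(_ isT isT isT) /= ji.
    by have := lt_le_trans (lt_trans zi zj) ji; rewrite ltxx.
  move=> i j _ _ [z [/= /andP[z1 z2] /andP[z3 z4]]]; apply/val_inj/eqP.
  have [ij|ij|//] := ltngtP (val i) (val j); exfalso.
    exact: disj ij z4 z1.
  exact: disj ij z2 z3.
- rewrite -lte_fin; apply: le_lt_trans mU; apply: (le_trans lU); apply: le_measure;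
    rewrite ?inE; [apply: measurableI => //|..]; try exact: open_measurable.
  exact: subIsetl.
Qed.

Lemma ae_deriv0_const (R : realType) (a b : \bar R) (F f : R -> R) (c d : R) :
  ac_deriv a b F f -> {ae leb, forall x : R, ooitv a b x -> f x = 0} ->
  ooitv a b c -> ooitv a b d -> F c = F d.
Proof.
move=> dF f0 hc hd.
wlog cd : c d hc hd / c <= d.
  by move=> H; have [/H|/ltW/H] := leP c d; [exact|move=> ->].
apply/eqP; rewrite eq_le (ae_deriv_ge0_le dF)//=; last first.
  by apply: filterS f0 => x /[apply] ->.
rewrite -lerN2 (ae_deriv_ge0_le (ac_deriv_opp dF))//.
by apply: filterS f0 => x /[apply] ->; rewrite oppr0.
Qed.

(** * Primitives of locally integrable functions *)

Lemma measurable_ooitv (R : realType) (a b : \bar R) :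
  measurable (ooitv a b : set (measurableTypeR R)).
Proof. by apply: open_measurable; exact: open_ooitv. Qed.

Lemma borel_leb_measurable (R : realType) (D : set R) :
  measurable (D : set (measurableTypeR R)) ->
  measurable (D : set (lebT R)).
Proof. exact: sub_caratheodory. Qed.

Lemma L1loc_measurable (R : realType) (a b : \bar R) (f : R -> R) :
  L1loc (ooitv a b) f -> lebesgue_measurable (ooitv a b) f.
Proof.
move=> Lf; have [[c cab]|nab] := pselect (exists c, ooitv a b c); last first.
  rewrite (_ : ooitv a b = set0); first exact: measurable_fun_set0.
  by rewrite -subset0 => x xab; apply: nab; exists x.
have [x [y [xy _ _ E]]] := ooitv_exhaust cab.
rewrite /lebesgue_measurable E; apply/measurable_fun_bigcup => // n.
  by apply: borel_leb_measurable; exact: measurable_itv.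
apply/measurable_EFinP; apply: (@measurable_int _ _ _ leb); apply: Lf.
  exact: segment_compact.
by move=> t /=; rewrite in_itv/=; have [? ? _ _] := xy n; exact: ooitv_between.
Qed.

(** Modify [f] on a Borel null set outside of which each rational superlevel set is
    Borel.  Differentiation of integrals is then applied to the Borel function. *)
Lemma borel_representative (R : realType) (D : set R) (f : R -> R) :
  measurable (D : set (measurableTypeR R)) -> lebesgue_measurable D f ->
  exists2 g : R -> R, measurable_fun [set: measurableTypeR R] (g : _ -> measurableTypeR R) &
    {ae leb, forall x : R, D x -> f x = g x}.
Proof.
move=> mD mf.
have mf0 : lebesgue_measurable setT (f \_ D).
  have H := (@measurable_restrictT _ _ (lebT R)
    (measurableTypeR R) D f (borel_leb_measurable mD)).
  exact: (proj1 H mf).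
have /choice[BN HBN] : forall q : rat, exists BN : set R * set R,
   [/\ measurable (BN.1 : set (measurableTypeR R)),
      measurable (BN.2 : set (measurableTypeR R)),
      (lebesgue_measure : set (measurableTypeR R) -> \bar R).-negligible BN.2 &
      forall x, ~ BN.2 x -> (BN.1 x <-> ratr q < (f \_ D) x)].
  move=> q.
  have : (wlength (R := R) idfun)^*%mu.-cara.-measurable ((f \_ D) @^-1` `]ratr q, +oo[%classic).
    rewrite -[X in measurable X]setTI; exact: mf0.
  rewrite -completed_caratheodory_measurable g_sigma_completed_algebra_genE.
  move=> [/= B mB [N' [N [/= mN N0 N'N]]] E].
  exists (B, N); split=> //=; first by exists N; split.
  move=> x Nx.
  have : (B `|` N') x <-> `]ratr q, +oo[%classic ((f \_ D) x) by rewrite E.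
  rewrite /= in_itv/= andbT => <-; split; [by left|by move=> [//|/N'N]].
pose N := \bigcup_q (BN q).2.
have mN : measurable (N : set (measurableTypeR R)).
  by apply: bigcupT_measurable_rat => q; have [] := HBN q.
have N0 : (lebesgue_measure : set (measurableTypeR R) -> \bar R).-negligible N.
  have [e he] : exists e : nat -> rat, forall q, exists n, e n = q.
    exists (fun n => odflt 0 (unpickle n)) => q; exists (pickle q); by rewrite pickleK.
  have : (lebesgue_measure : set (measurableTypeR R) -> \bar R).-negligible
      (\bigcup_n (BN (e n)).2).
    by apply: negligible_bigcup => n; have [] := HBN (e n).
  by apply: negligibleS => x [q _ Nqx]; have [n qn] := he q; exists n; rewrite ?qn.
pose g x := if x \in N then 0 else (f \_ D) x.
exists g.
  apply: (measurability _ (RGenOInfty.measurableE R)) => //.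
  move=> _ [_ [t ->] <-]; rewrite setTI.
  have -> : g @^-1` `]t, +oo[%classic =
     \bigcup_(q in [set q | t < ratr q]) (((BN q).1 `\` N) `|`
        (if ratr q < 0 :> R then N else set0)).
    apply/seteqP; split=> x /=.
    - rewrite in_itv/= andbT => /rat_in_itvoo[q]; rewrite in_itv/= => /andP[tq qg].
      exists q => //; move: qg; rewrite /g; case: ifPn => [|/negP]; rewrite inE => Nx qf.
        by right; rewrite qf.
      left; split=> //; have [_ _ _ /(_ x)[]] := HBN q; last by move=> _; apply.
      by move=> h; apply: Nx; exists q.
    - move=> [q /= tq]; rewrite in_itv/= andbT /g => -[[Bx Nx]|]; last first.
        case: ifPn => // q0 Nx; rewrite mem_set//; exact: lt_trans q0.
      rewrite memNset//; apply: lt_trans tq _; have [_ _ _ /(_ x)[]] := HBN q; last by move=> h _; exact: h.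
      by move=> h; apply: Nx; exists q.
  rewrite bigcup_mkcond; apply: bigcupT_measurable_rat => q; case: ifPn => // _.
  apply: measurableU; last by case: ifPn.
  by apply: measurableD => //; have [] := HBN q.
have := leb_negligible_of N0; apply: negligibleS => x /=.
move=> /not_implyP[Dx fg]; apply: contrapT => Nx; apply: fg.
by rewrite /g memNset// patchE mem_set.
Qed.

(** On Borel sets, Lebesgue measure is the pushforward of its completion under the
    identity. *)
Lemma integrable_borel (R : realType) (D : set R) (f g : R -> R) :
  measurable (D : set (measurableTypeR R)) ->
  measurable_fun [set: measurableTypeR R] (g : _ -> measurableTypeR R) ->
  {ae leb, forall x : R, D x -> f x = g x} ->
  leb.-integrable D (EFin \o f) ->
  lebesgue_measure.-integrable (D : set (measurableTypeR R)) (EFin \o g) /\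
  (\int[leb]_(x in D) (f x)%:E = \int[lebesgue_measure]_(x in (D : set (measurableTypeR R))) (g x)%:E)%E.
Proof.
move=> mD mg fg intf.
have mid : measurable_fun [set: lebT R]
    (idfun : _ -> measurableTypeR R).
  by move=> _ Y mY; rewrite setTI; exact: borel_leb_measurable.
have mgl : measurable_fun [set: lebT R]
    (g : _ -> measurableTypeR R).
  exact: measurableT_comp mg mid.
have mDl := borel_leb_measurable mD.
have intg : leb.-integrable D (EFin \o g).
  move/integrableP : intf => [mf intf]; apply/integrableP; split.
    by apply/measurable_EFinP; exact: measurable_funTS.
  apply: le_lt_trans intf; rewrite le_eqVlt; apply/orP; left; apply/eqP.
  apply: ge0_ae_eq_integral.
  - exact: mDl.
  - by apply: measurableT_comp => //; apply/measurable_EFinP; exact: measurable_funTS.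
  - exact: measurableT_comp.
  - by move=> x _; exact: abse_ge0.
  - by move=> x _; exact: abse_ge0.
  - by apply: filterS fg => x /= h Dx; rewrite h.
have mgE : measurable_fun [set: measurableTypeR R] (EFin \o g) by exact/measurable_EFinP.
split; first exact: (integrable_pushforward mid mgE intg mD).
transitivity (\int[leb]_(x in D) (g x)%:E)%E.
  apply: ae_eq_integral.
  - exact: mDl.
  - exact: measurable_int intf.
  - exact: measurable_int intg.
  - by apply: filterS fg => x /= h Dx; rewrite h.
by rewrite -(integral_pushforward mid mgE intg mD).
Qed.

(** Absolute continuity of the integral of [`|g|] over sets of small measure, applied
    to the union of the intervals. *)
Lemma abs_continuous_integral (R : realType) (c d : R) (g G : R -> R) :
  lebesgue_measure.-integrable (`[c, d]%classic : set (measurableTypeR R)) (EFin \o g) ->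
  (forall s t, c <= s -> s <= t -> t <= d ->
     G t - G s = (\int[lebesgue_measure]_(x in `[s, t]) g x)%R) ->
  abs_continuous c d G.
Proof.
move=> intg GE e e0.
pose h := g \_ `[c, d].
have inth : lebesgue_measure.-integrable [set: measurableTypeR R] (EFin \o h).
  by rewrite -restrict_EFin; apply/integrable_restrict => //; rewrite setTI.
have [de [de0 H]] := integral_normr_continuous inth e0.
exists de => // n s t st tI std.
pose I (i : 'I_n) : set (measurableTypeR R) := `]s i, t i[%classic.
have mI i : measurable (I i) by exact: measurable_itv.
have tI' : trivIset [set: 'I_n] I.
  move=> i j _ _ [x [/= xi xj]]; apply: tI => //; exists x; split=> /=.
    by move: xi; rewrite /I/= in_itv.
  by move: xj; rewrite /I/= in_itv.
pose D := \big[setU/set0]_(i < n) I i.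
have mD : measurable (D : set (measurableTypeR R)) by exact: bigsetU_measurable.
have Dlt : (lebesgue_measure D < de%:E)%E.
  rewrite measure_bigsetU_ord//.
  rewrite (eq_bigr (fun i => (t i - s i)%:E)); first by rewrite sumEFin lte_fin.
  move=> i _; rewrite [LHS](lebesgue_measure_itv `]s i, t i[)/= lte_fin.
  have [_ +  _] := st i; rewrite le_eqVlt => /predU1P[->|->]; last by rewrite EFinB.
  by rewrite ltxx subrr.
apply: le_lt_trans (H _ mD Dlt).
have mh : measurable_fun [set: measurableTypeR R] (h : _ -> measurableTypeR R).
  by apply/measurable_EFinP; exact: measurable_int inth.
rewrite -lee_fin -sumEFin /Rintegral fineK; last first.
  apply: (@integrable_fin_num _ _ _ lebesgue_measure D) => //.
  apply: (@integrableS _ _ _ _ [set: measurableTypeR R]) => //.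
  exact: integrable_abse inth.
rewrite ge0_integral_bigsetU//; last 3 first.
- exact: index_enum_uniq.
- by apply: sub_trivIset tI'.
- by apply/measurable_EFinP; apply: measurableT_comp => //; exact: measurable_funTS.
apply: lee_sum => i _; have [cs st' td] := st i.
have intgi : lebesgue_measure.-integrable (`[s i, t i]%classic : set (measurableTypeR R)) (EFin \o g).
  apply: integrableS intg => //; try exact: measurable_itv.
  by apply: subset_itv; rewrite bnd_simp.
rewrite GE//; apply: (@le_trans _ _ ((\int[lebesgue_measure]_(x in `[s i, t i]) `|g x|)%R%:E)).
  by rewrite lee_fin; apply: le_normr_Rintegral.
rewrite /Rintegral fineK; last first.
  apply: (@integrable_fin_num _ _ _ lebesgue_measure) => //.
  exact: integrable_abse intgi.
rewrite (_ : (\int[lebesgue_measure]_(x in `[s i, t i]) `|g x|%:E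
   = \int[lebesgue_measure]_(x in `[s i, t i]) `|h x|%:E)%E); last first.
  apply: eq_integral => x; rewrite inE /= in_itv/= => /andP[sx xt].
  by rewrite /h patchE mem_set//= in_itv/= (le_trans cs)// (le_trans xt).
rewrite integral_itv_bndoo//.
by apply/measurable_EFinP; apply: measurableT_comp => //; exact: measurable_funTS.
Qed.

(** The integral from a base point, which is differentiable at the Lebesgue points of
    a Borel representative. *)
Lemma L1loc_primitive (R : realType) (a b : \bar R) (f : R -> R) :
  L1loc (ooitv a b) f ->
  exists2 F : R -> R, ac_deriv a b F f &
    forall s t, ooitv a b s -> ooitv a b t -> s <= t ->
      (F t - F s)%:E = (\int[leb]_(x in `[s, t]) (f x)%:E)%E.
Proof.
move=> Lf; have mf := L1loc_measurable Lf.
have [[c cab]|nab] := pselect (exists c, ooitv a b c); last first.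
  exists (fun=> 0); last by move=> s t sab; exfalso; apply: nab; exists s.
  split; first exact: ACloc_cst.
  by apply: aeW => x xab; exfalso; apply: nab; exists x.
have [g mg fg] := borel_representative (measurable_ooitv a b) mf.
have sub s t : ooitv a b s -> ooitv a b t -> `[s, t]%classic `<=` ooitv a b.
  by move=> sab tab x /=; rewrite in_itv/=; exact: ooitv_between.
have ig s t : ooitv a b s -> ooitv a b t ->
    lebesgue_measure.-integrable (`[s, t]%classic : set (measurableTypeR R)) (EFin \o g) /\
    (\int[leb]_(x in `[s, t]) (f x)%:E = \int[lebesgue_measure]_(x in `[s, t]) (g x)%:E)%E.
  move=> sab tab; apply: integrable_borel => //.
    by apply: filterS fg => x h /(sub _ _ sab tab); exact: h.
  by apply: Lf; [exact: segment_compact|exact: sub].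
pose I s t := (\int[lebesgue_measure]_(x in `[s, t]) g x)%R.
have Iadd s m t : ooitv a b s -> ooitv a b t -> s <= m -> m <= t -> I s t = I s m + I m t.
  move=> sab tab sm mt; have [igst _] := ig _ _ sab tab.
  apply/eqP; rewrite addrC -subr_eq /I Rintegral_itvB// ?bnd_simp//.
  rewrite Rintegral_itv_obnd_cbnd//.
  apply: integrableS igst => //; try exact: measurable_itv.
  by apply: subset_itv; rewrite bnd_simp.
pose G x := if c <= x then I c x else - I x c.
have GE s t : ooitv a b s -> ooitv a b t -> s <= t -> G t - G s = I s t.
  move=> sab tab st; rewrite /G; have [cs|sc] := leP c s.
    rewrite (le_trans cs st) (Iadd c s t)//; ring.
  have [ct|tc] := leP c t.
    by rewrite opprK addrC -Iadd// ltW.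
  rewrite (Iadd s t c)// ?(ltW tc)//; ring.
exists G; last first.
  move=> s t sab tab st; rewrite (GE _ _ sab tab st); have [igst ->] := ig _ _ sab tab.
  by rewrite /I /Rintegral fineK//; exact: integrable_fin_num.
split.
  move=> u v uab vab; apply: abs_continuous_integral; first exact: (ig _ _ uab vab).1.
  move=> s t us st tv; apply: GE => //; apply: (ooitv_between uab vab).
    by rewrite us (le_trans st).
  by rewrite tv (le_trans us).
have [x [y [xy _ xyE _]]] := ooitv_exhaust cab.
suff H n : {ae leb, forall z, x n < z < y n -> is_derive z (1:R) G (g z)}.
  suff : {ae leb, forall z n, x n < z < y n -> is_derive z (1:R) G (g z)}.
    apply: filterS2 fg => z h1 h2 zab; have [n zn] := xyE _ zab.
    by rewrite h1//; exact: h2 zn.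
  apply: negligibleS (negligible_bigcup H) => z /= /existsNP[n hn]; exists n => //.
have [xab yab xc cy] := xy n.
have xny : x n < y n by exact: lt_trans cy.
have [igxy _] := ig _ _ xab yab.
have := lebesgue_differentiation (integrable_locally_restrict _ igxy).
move=> /(_ (measurable_itv _)) Hl.
have {}Hl : {ae leb, forall z : R, lebesgue_pt (g \_ `[x n, y n]) z}.
  exact: leb_negligible_of Hl.
apply: filterS Hl => z Hz /andP[xz zy].
pose h := g \_ `[x n, y n].
have igh : lebesgue_measure.-integrable (`[x n, y n]%classic : set (measurableTypeR R)) (EFin \o h).
  apply: eq_integrable igxy => //.
  by move=> u uI /=; rewrite /h patchE uI.
have [|dG Gz] := @FTC1_lebesgue_pt R h (BLeft (x n)) z (y n) zy igh _ Hz.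
  by rewrite lte_fin.
have nearG : \forall u \near z, G u = G (x n) + (\int[lebesgue_measure]_(t in `[x n, u]) h t)%R.
  have : nbhs z `]x n, y n[%classic.
    by apply: open_nbhs_nbhs; split; [exact: interval_open|rewrite /= in_itv/= xz].
  apply: filterS => u /=; rewrite in_itv/= => /andP[xu uy].
  have uab : ooitv a b u by apply: (ooitv_between xab yab); rewrite !ltW.
  apply/eqP; rewrite addrC -subr_eq (GE _ _ xab uab (ltW xu)); apply/eqP.
  apply: eq_Rintegral => v; rewrite inE/= in_itv/= => /andP[xv vu].
  by rewrite /h patchE mem_set//= in_itv/= xv (le_trans vu)// ltW.
apply: (near_eq_is_derive (f := (fun u => G (x n) + (\int[lebesgue_measure]_(t in `[x n, u]) h t)%R) : R^o -> R^o)).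
  by apply: filterS nearG => u ->.
have gz : g z = h z by rewrite /h patchE mem_set//= in_itv/= !ltW.
rewrite gz -[h z]add0r; apply: is_deriveD.
apply: DeriveDef; [exact: dG|rewrite -derive1E; exact: Gz].
Qed.

(** * Locally integrable functions and Gronwall's inequality *)

Lemma L1loc_add (R : realType) (D : set R) (f g : R -> R) :
  L1loc D f -> L1loc D g -> L1loc D (fun x => f x + g x).
Proof.
move=> Lf Lg K cK KD; have mK : measurable (K : set (measurableTypeR R)).
  exact: compact_measurable.
have := integrableD (borel_leb_measurable mK) (Lf K cK KD) (Lg K cK KD).
by apply: eq_integrable => //; exact: borel_leb_measurable.
Qed.

Lemma L1loc_abs (R : realType) (D : set R) (f : R -> R) :
  L1loc D f -> L1loc D (fun x => `|f x|).
Proof. by move=> Lf K cK KD; exact: integrable_abse (Lf K cK KD). Qed.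

Lemma L1loc_sub (R : realType) (D D' : set R) (f : R -> R) :
  D' `<=` D -> L1loc D f -> L1loc D' f.
Proof. by move=> D'D Lf K cK KD'; apply: Lf => //; exact: subset_trans D'D. Qed.

Lemma continuous_leb_measurable (R : realType) (D : set R) (f : R -> R) :
  measurable (D : set (measurableTypeR R)) ->
  {within D, continuous f} -> lebesgue_measurable D f.
Proof.
move=> mD cf; have mf := subspace_continuous_measurable_fun mD cf.
by move=> _ Y mY; apply: borel_leb_measurable; exact: mf.
Qed.

Lemma L1loc_mull (R : realType) (a b : \bar R) (f g : R -> R) :
  (forall x, ooitv a b x -> {for x, continuous f}) ->
  L1loc (ooitv a b) g -> L1loc (ooitv a b) (fun x => f x * g x).
Proof.
move=> cf Lg K cK KD; have mK : measurable (K : set (measurableTypeR R)).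
  exact: compact_measurable.
have cfK : {within K, continuous f}.
  by apply: continuous_in_subspaceT => x; rewrite inE => /KD; exact: cf.
apply: (integrableMr (borel_leb_measurable mK)) (Lg K cK KD).
  exact: continuous_leb_measurable.
have /compact_bounded[M [Mr HM]] := continuous_compact cfK cK.
by exists M; split=> // y My x Kx; apply: (HM y My); exists x.
Qed.

Lemma ac_deriv_sub (R : realType) (a b a' b' : \bar R) (F f : R -> R) :
  ooitv a' b' `<=` ooitv a b -> ac_deriv a b F f -> ac_deriv a' b' F f.
Proof.
move=> ab [acF dF]; split; first by move=> c d /ab hc /ab; exact: acF.
by apply: filterS dF => x h /ab.
Qed.

(** With [K] a primitive of [k], the functions [N * exp K] and [N * exp (- K)] are
    monotone.  The absolute value covers both directions of propagation. *)
Lemma gronwall (R : realType) (a b : \bar R) (N N' k K : R -> R) (s t : R) :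
  ac_deriv a b N N' -> ac_deriv a b K k ->
  {ae leb, forall x : R, ooitv a b x -> `|N' x| <= k x * N x} ->
  (forall x, ooitv a b x -> 0 <= N x) ->
  ooitv a b s -> ooitv a b t -> N t <= N s * expR `|K t - K s|.
Proof.
move=> dN dK bN N0 sab tab.
have [st|/ltW ts] := leP s t.
- have d1 := ac_deriv_opp (ac_deriv_mul dN (ac_deriv_expR (ac_deriv_opp dK))).
  have := ae_deriv_ge0_le d1 _ sab tab st => h.
  have {h} : - (N s * expR (- K s)) <= - (N t * expR (- K t)).
    apply: h; apply: filterS bN => x /[apply]; rewrite ler_norml => /andP[_ h].
    have := expR_gt0 (- K x) => e0; rewrite oppr_ge0.
    have -> : N' x * expR (- K x) + N x * (expR (- K x) * - k x)
      = expR (- K x) * (N' x - k x * N x) by ring.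
    by rewrite pmulr_rle0// subr_le0.
  rewrite lerN2 => h.
  have : N t <= N s * expR (K t - K s).
    have := ler_wpM2r (expR_ge0 (K t)) h.
    by rewrite -!mulrA -!expRD addNr expR0 mulr1 (addrC (- K s)).
  move=> /le_trans; apply; apply: ler_wpM2l; first exact: N0.
  by rewrite ler_expR ler_norm.
- have d1 := ac_deriv_mul dN (ac_deriv_expR dK).
  have := ae_deriv_ge0_le d1 _ tab sab ts => h.
  have {h} : N t * expR (K t) <= N s * expR (K s).
    apply: h; apply: filterS bN => x /[apply]; rewrite ler_norml => /andP[h _].
    have := expR_gt0 (K x) => e0.
    have -> : N' x * expR (K x) + N x * (expR (K x) * k x)
      = expR (K x) * (N' x - - (k x * N x)) by ring.
    by rewrite pmulr_rge0// subr_ge0.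
  move=> h.
  have : N t <= N s * expR (K s - K t).
    have := ler_wpM2r (expR_ge0 (- K t)) h.
    by rewrite -!mulrA -!expRD addrN expR0 mulr1.
  move=> /le_trans; apply; apply: ler_wpM2l; first exact: N0.
  by rewrite ler_expR distrC ler_norm.
Qed.

(** * The first-order system of a complex solution *)

(** The equation u' = P w, w' = (Q - i r) u with P = 1 / p for the complex functions
    u = u1 + i u2 and w = w1 + i w2, split into real and imaginary parts.  With
    Q = q - (Re z) r and with (Im z) r for r it is the equation at z; with r = 0 and
    u2 = w2 = 0 it is the equation of a real solution at a real parameter. *)
Definition solution_system (R : realType) (a b : \bar R) (P Q r : R -> R)
    (u1 w1 u2 w2 : R -> R) : Prop :=
  [/\ ac_deriv a b u1 (fun x => P x * w1 x),
      ac_deriv a b w1 (fun x => Q x * u1 x + r x * u2 x),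
      ac_deriv a b u2 (fun x => P x * w2 x) &
      ac_deriv a b w2 (fun x => Q x * u2 x - r x * u1 x)].

(** Uniqueness of the initial value problem: |u|^2 + |w|^2 satisfies the hypothesis of
    Gronwall's inequality with rate |P + Q| + |r|. *)
Lemma solution_system_eq0 (R : realType) (a b : \bar R) (P Q r : R -> R)
    (u1 w1 u2 w2 : R -> R) (s t : R) :
  L1loc (ooitv a b) P -> L1loc (ooitv a b) Q -> L1loc (ooitv a b) r ->
  solution_system a b P Q r u1 w1 u2 w2 -> ooitv a b s -> ooitv a b t ->
  u1 s ^+ 2 + u2 s ^+ 2 + w1 s ^+ 2 + w2 s ^+ 2 = 0 ->
  u1 t ^+ 2 + u2 t ^+ 2 + w1 t ^+ 2 + w2 t ^+ 2 = 0.
Proof.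
move=> LP LQ Lr [h1 h2 h3 h4] sab tab Ns.
have [K dK _] := L1loc_primitive (L1loc_add (L1loc_abs (L1loc_add LP LQ)) (L1loc_abs Lr)).
have N0 x : 0 <= u1 x * u1 x + u2 x * u2 x + w1 x * w1 x + w2 x * w2 x.
  by rewrite !addr_ge0// -expr2 sqr_ge0.
have sq (f : R -> R) f' (df : ac_deriv a b f f') := ac_deriv_mul df df.
have dN := ac_deriv_add (ac_deriv_add (ac_deriv_add (sq _ _ h1) (sq _ _ h3)) (sq _ _ h2)) (sq _ _ h4).
have := gronwall dN dK _ (fun x _ => N0 x) sab tab.
rewrite -!expr2 Ns mul0r => H; apply/eqP; rewrite eq_le; apply/andP; split.
  apply: H; apply: aeW => x _ /=.
  set A := u1 x; set B := u2 x; set C := w1 x; set D := w2 x.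
  have -> : P x * C * A + A * (P x * C) + (P x * D * B + B * (P x * D)) +
     ((Q x * A + r x * B) * C + C * (Q x * A + r x * B)) +
     ((Q x * B - r x * A) * D + D * (Q x * B - r x * A)) =
     (P x + Q x) * ((A * C + B * D) *+ 2) + r x * ((B * C - A * D) *+ 2).
    by ring.
  rewrite [leRHS]mulrDl (le_trans (ler_normD _ _))// lerD// normrM ler_wpM2l//.
    rewrite ler_norml; have := sqr_ge0 (A - C); have := sqr_ge0 (A + C).
    have := sqr_ge0 (B - D); have := sqr_ge0 (B + D); clear; nra.
  rewrite ler_norml; have := sqr_ge0 (B - C); have := sqr_ge0 (B + C).
  have := sqr_ge0 (A - D); have := sqr_ge0 (A + D); clear; nra.
by rewrite !addr_ge0// sqr_ge0.
Qed.

(** Write Y = (u, w) and |Y|^2 = |u|^2 + |w|^2.  The vector (- conj w, conj u) / |Y|^2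
    has determinant 1 with Y, and adding h Y to it keeps the determinant.  The
    system has trace zero, so the defect of this vector as a solution is parallel to
    Y and is cancelled by h with
    h' = |Y|^-4 ((P + Q + i r) (conj u)^2 - (P + Q - i r) (conj w)^2).
    Unlike reduction of order, this has no singularity at zeros of u.  The final
    equation is the real part of the determinant. *)
Lemma second_solution (R : realType) (a b : \bar R) (P Q r : R -> R)
    (u1 w1 u2 w2 : R -> R) :
  L1loc (ooitv a b) P -> L1loc (ooitv a b) Q -> L1loc (ooitv a b) r ->
  solution_system a b P Q r u1 w1 u2 w2 ->
  (forall x, ooitv a b x -> u1 x ^+ 2 + u2 x ^+ 2 + w1 x ^+ 2 + w2 x ^+ 2 != 0) ->
  exists v1 x1 v2 x2 : R -> R, solution_system a b P Q r v1 x1 v2 x2 /\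
    forall x, ooitv a b x -> u1 x * x1 x - u2 x * x2 x - (w1 x * v1 x - w2 x * v2 x) = 1.
Proof.
move=> LP LQ Lr [h1 h2 h3 h4] N0.
pose N x := u1 x * u1 x + u2 x * u2 x + w1 x * w1 x + w2 x * w2 x.
have N0' x : ooitv a b x -> N x != 0 by exact: N0.
have sq (f : R -> R) f' (df : ac_deriv a b f f') := ac_deriv_mul df df.
have dN : ac_deriv a b N _ :=
  ac_deriv_add (ac_deriv_add (ac_deriv_add (sq _ _ h1) (sq _ _ h3)) (sq _ _ h2)) (sq _ _ h4).
have dm := ac_deriv_inv dN N0'.
set m := fun x => (N x)^-1 in dm.
have LA := L1loc_add LP LQ.
have cont F f : ac_deriv a b F f -> forall x, ooitv a b x -> {for x, continuous F}.
  by move=> [acF _] x; exact: ACloc_continuous.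
have cm := ac_deriv_mul dm dm.
(* The coefficients of P + Q and of r in the real part of h' ([c1], [c2]) and in
   its imaginary part ([c3], [c4]); they are continuous, so h' is locally
   integrable. *)
have c1 := ac_deriv_mul cm (ac_deriv_add
   (ac_deriv_add (sq _ _ h1) (ac_deriv_opp (sq _ _ h3)))
   (ac_deriv_opp (ac_deriv_add (sq _ _ h2) (ac_deriv_opp (sq _ _ h4))))).
have c2 := ac_deriv_mul (ac_deriv_mul cm (ac_deriv_cst a b 2))
   (ac_deriv_add (ac_deriv_mul h1 h3) (ac_deriv_mul h2 h4)).
have c3 := ac_deriv_mul (ac_deriv_mul cm (ac_deriv_cst a b 2))
   (ac_deriv_add (ac_deriv_opp (ac_deriv_mul h1 h3)) (ac_deriv_mul h2 h4)).
have c4 := ac_deriv_mul cm (ac_deriv_add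
   (ac_deriv_add (sq _ _ h1) (ac_deriv_opp (sq _ _ h3)))
   (ac_deriv_add (sq _ _ h2) (ac_deriv_opp (sq _ _ h4)))).
have [k1 dk1 _] := L1loc_primitive (L1loc_add (L1loc_mull (cont _ _ c1) LA)
   (L1loc_mull (cont _ _ c2) Lr)).
have [k2 dk2 _] := L1loc_primitive (L1loc_add (L1loc_mull (cont _ _ c3) LA)
   (L1loc_mull (cont _ _ c4) Lr)).
exists (fun x => - (w1 x * m x) + (u1 x * k1 x + - (u2 x * k2 x))).
exists (fun x => u1 x * m x + (w1 x * k1 x + - (w2 x * k2 x))).
exists (fun x => w2 x * m x + (u1 x * k2 x + u2 x * k1 x)).
exists (fun x => - (u2 x * m x) + (w1 x * k2 x + w2 x * k1 x)).
split; last first.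
  move=> x xab; rewrite /m; have := N0' x xab; rewrite /N => NN; field; exact: NN.
split.
- apply: (ac_deriv_eq (ac_deriv_add (ac_deriv_opp (ac_deriv_mul h2 dm)) (ac_deriv_add
    (ac_deriv_mul h1 dk1) (ac_deriv_opp (ac_deriv_mul h3 dk2))))).
  apply: aeW => x xab /=; rewrite /m; have := N0' x xab; rewrite /N => NN; field; exact: NN.
- apply: (ac_deriv_eq (ac_deriv_add (ac_deriv_mul h1 dm) (ac_deriv_add
    (ac_deriv_mul h2 dk1) (ac_deriv_opp (ac_deriv_mul h4 dk2))))).
  apply: aeW => x xab /=; rewrite /m; have := N0' x xab; rewrite /N => NN; field; exact: NN.
- apply: (ac_deriv_eq (ac_deriv_add (ac_deriv_mul h4 dm) (ac_deriv_add
    (ac_deriv_mul h1 dk2) (ac_deriv_mul h3 dk1)))).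
  apply: aeW => x xab /=; rewrite /m; have := N0' x xab; rewrite /N => NN; field; exact: NN.
- apply: (ac_deriv_eq (ac_deriv_add (ac_deriv_opp (ac_deriv_mul h3 dm)) (ac_deriv_add
    (ac_deriv_mul h2 dk2) (ac_deriv_mul h4 dk1)))).
  apply: aeW => x xab /=; rewrite /m; have := N0' x xab; rewrite /N => NN; field; exact: NN.
Qed.

(** Variation of parameters: v = alpha u + beta s with W alpha = v ws - x s and
    W beta = u x - wu v.  Here u and s solve the equation at a real lambda and v
    solves it at lambda + i, so that W alpha' = i r v s and W beta' = - i r v u, and
    |alpha|^2 + |beta|^2 grows at rate at most r (u^2 + s^2) / |W|. *)
Lemma solution_bound (R : realType) (a b : \bar R) (P Q r K : R -> R)
    (u wu s ws v1 x1 v2 x2 : R -> R) (W c : R) :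
  {ae leb, forall x : R, ooitv a b x -> 0 < r x} ->
  ac_deriv a b u (fun x => P x * wu x) -> ac_deriv a b wu (fun x => Q x * u x) ->
  ac_deriv a b s (fun x => P x * ws x) -> ac_deriv a b ws (fun x => Q x * s x) ->
  W != 0 -> (forall x, ooitv a b x -> u x * ws x - wu x * s x = W) ->
  ac_deriv a b K (fun x => (u x * u x + s x * s x) * r x) ->
  solution_system a b P Q r v1 x1 v2 x2 ->
  ooitv a b c -> exists2 N, 0 <= N & forall x, ooitv a b x ->
    v1 x ^+ 2 + v2 x ^+ 2 <= N * expR (`|W|^-1 * `|K x - K c|) * (u x ^+ 2 + s x ^+ 2).
Proof.
move=> r0 du dwu ds dws W0 WE dK [dv1 dx1 dv2 dx2] cab.
have lin f g f' g' h k h' k' (df : ac_deriv a b f f') (dg : ac_deriv a b g g')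
  (dh : ac_deriv a b h h') (dk : ac_deriv a b k k') :=
  ac_deriv_mul (ac_deriv_cst a b W^-1) (ac_deriv_add (ac_deriv_mul df dg) (ac_deriv_opp (ac_deriv_mul dh dk))).
pose a1 x := W^-1 * (v1 x * ws x + - (x1 x * s x)).
pose a2 x := W^-1 * (v2 x * ws x + - (x2 x * s x)).
pose b1 x := W^-1 * (u x * x1 x + - (wu x * v1 x)).
pose b2 x := W^-1 * (u x * x2 x + - (wu x * v2 x)).
have da1 : ac_deriv a b a1 (fun x => - (W^-1 * r x * v2 x * s x)).
  by apply: (ac_deriv_eq (lin _ _ _ _ _ _ _ _ dv1 dws dx1 ds)); apply: aeW => x _; ring.
have da2 : ac_deriv a b a2 (fun x => W^-1 * r x * v1 x * s x).
  by apply: (ac_deriv_eq (lin _ _ _ _ _ _ _ _ dv2 dws dx2 ds)); apply: aeW => x _; ring.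
have db1 : ac_deriv a b b1 (fun x => W^-1 * r x * v2 x * u x).
  by apply: (ac_deriv_eq (lin _ _ _ _ _ _ _ _ du dx1 dwu dv1)); apply: aeW => x _; ring.
have db2 : ac_deriv a b b2 (fun x => - (W^-1 * r x * v1 x * u x)).
  by apply: (ac_deriv_eq (lin _ _ _ _ _ _ _ _ du dx2 dwu dv2)); apply: aeW => x _; ring.
have sq (f : R -> R) f' (df : ac_deriv a b f f') := ac_deriv_mul df df.
have dN := ac_deriv_add (ac_deriv_add (ac_deriv_add (sq _ _ da1) (sq _ _ da2)) (sq _ _ db1)) (sq _ _ db2).
have N0 x : 0 <= a1 x * a1 x + a2 x * a2 x + b1 x * b1 x + b2 x * b2 x.
  by rewrite !addr_ge0// -expr2 sqr_ge0.
have dK' := ac_deriv_mul (ac_deriv_cst a b (`|W|^-1)) dK.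
exists (a1 c * a1 c + a2 c * a2 c + b1 c * b1 c + b2 c * b2 c) => // x xab.
have G := gronwall dN dK' _ (fun y _ => N0 y) cab xab.
rewrite -mulrBr normrM (ger0_norm (x := `|W|^-1)) ?invr_ge0// in G.
have V1 : v1 x = a1 x * u x + b1 x * s x.
  by rewrite /a1 /b1; move: W0; rewrite -(WE x xab) => W0; field.
have V2 : v2 x = a2 x * u x + b2 x * s x.
  by rewrite /a2 /b2; move: W0; rewrite -(WE x xab) => W0; field.
apply: (@le_trans _ _ ((a1 x * a1 x + a2 x * a2 x + b1 x * b1 x + b2 x * b2 x) * (u x ^+ 2 + s x ^+ 2))).
  rewrite V1 V2; have := sqr_ge0 (a1 x * s x - b1 x * u x).
  by have := sqr_ge0 (a2 x * s x - b2 x * u x); clear; lra.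
rewrite ler_wpM2r ?addr_ge0 ?sqr_ge0//; apply: G.
apply: filterS r0 => y h yab; have {h}ry := h yab.
have E1 : v1 y = a1 y * u y + b1 y * s y.
  by rewrite /a1 /b1; move: W0; rewrite -(WE y yab) => W0; field.
have E2 : v2 y = a2 y * u y + b2 y * s y.
  by rewrite /a2 /b2; move: W0; rewrite -(WE y yab) => W0; field.
set A1 := a1 y; set A2 := a2 y; set B1 := b1 y; set B2 := b2 y.
(* Up to the factor r / W, twice Im (conj (beta) alpha) times u^2 + s^2. *)
rewrite [X in `|X|](_ : _ = W^-1 * ((u y * u y + s y * s y) * r y) * ((A2 * B1 - A1 * B2) *+ 2)).
  rewrite mul0r add0r !normrM (ger0_norm (ltW ry)).
  rewrite (ger0_norm (x := u y * u y + s y * s y)) ?addr_ge0// -?expr2 ?sqr_ge0//.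
  rewrite normfV ler_wpM2l ?mulr_ge0 ?invr_ge0 ?addr_ge0 ?sqr_ge0 ?(ltW ry)//.
  rewrite ler_norml; have := sqr_ge0 (A2 - B1); have := sqr_ge0 (A2 + B1).
  have := sqr_ge0 (A1 - B2); have := sqr_ge0 (A1 + B2); clear; nra.
transitivity (W^-1 * r y * ((A2 * v1 y - A1 * v2 y) * s y + (B1 * v2 y - B2 * v1 y) * u y) *+ 2).
  rewrite /A1 /A2 /B1 /B2; clear; ring.
rewrite E1 E2 -/A1 -/A2 -/B1 -/B2; clear; ring.
Qed.

(** * Integrability near an endpoint *)

Lemma integrable_union (R : realType) (A B : set R) (f : R -> R) :
  measurable (A : set (measurableTypeR R)) -> measurable (B : set (measurableTypeR R)) ->
  leb.-integrable A (EFin \o f) -> leb.-integrable B (EFin \o f) ->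
  leb.-integrable (A `|` B) (EFin \o f).
Proof.
move=> mA mB iA iB.
have mAl := borel_leb_measurable mA; have mBl := borel_leb_measurable mB.
have mBA := measurableD mBl mAl.
have iBA : leb.-integrable (B `\` A) (EFin \o f).
  exact: (integrableS mBl mBA (@subDsetl _ B A) iB).
have mU : measurable_fun ((A `|` (B `\` A)) : set (lebT R)) (EFin \o f).
  by apply/measurable_funU => //; split; [exact: measurable_int iA|exact: measurable_int iBA].
have AB : A `|` B `\` A = A `|` B.
  by apply/seteqP; split=> x; [move=> [|[]]; [left|right]|
    move=> h; have [Ax|nAx] := pselect (A x); [left|right; split=> //; case: h]].
rewrite -AB; apply/integrableP; split; first exact: mU.
rewrite (ge0_integral_setU _ mAl mBA).
- apply: lte_add_pinfty; first by move/integrableP : iA => [].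
  by move/integrableP : iBA => [].
- exact: measurableT_comp mU.
- by move=> x _; exact: abse_ge0.
- by apply/disj_setPS => x [Ax [_ /(_ Ax)]].
Qed.

Lemma near_end_ooitv (R : realType) (a b : \bar R) (e : endpoint) (c : R) :
  exists a' b', near_end a b e c = ooitv a' b'.
Proof. by case: e; [exists a, c%:E|exists c%:E, b]. Qed.

Lemma near_end_sub (R : realType) (a b : \bar R) (e : endpoint) (c : R) :
  ooitv a b c -> near_end a b e c `<=` ooitv a b.
Proof.
move=> [ac cb]; case: e => x [/= h1 h2]; split => //.
  exact: lt_trans cb.
exact: lt_trans h1.
Qed.

Lemma near_end_exists (R : realType) (a b : \bar R) (e : endpoint) (c : R) :
  ooitv a b c -> exists x, near_end a b e c x.
Proof.
move=> [ac cb]; case: e => /=.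
  have [x [h _ _]] := approx_left ac; exists (x 0%N).
  by have [h1 h2] := h 0%N; split.
have [x [h _ _]] := approx_right cb; exists (x 0%N).
by have [h1 h2] := h 0%N; split.
Qed.

Lemma measurable_near_end (R : realType) (a b : \bar R) (e : endpoint) (c : R) :
  measurable (near_end a b e c : set (measurableTypeR R)).
Proof. by case: e; exact: measurable_ooitv. Qed.

Lemma near_end_cover (R : realType) (a b : \bar R) (e : endpoint) (c c' : R) :
  ooitv a b c -> ooitv a b c' ->
  near_end a b e c `<=` near_end a b e c' `|` `[Num.min c c', Num.max c c'].
Proof.
move=> cab cab'; case: e => x [/= h1 h2].
  have [xc'|c'x] := ltP x c'; [left; split=> //|right; rewrite /= in_itv/=].
  by move: h2; rewrite lte_fin => h2; rewrite ge_min c'x orbT le_max ltW.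
have [xc'|c'x] := ltP c' x; [left; split=> //|right; rewrite /= in_itv/=].
by move: h1; rewrite lte_fin => h1; rewrite ge_min ltW//= le_max c'x orbT.
Qed.

(** Square integrability near an endpoint does not depend on the cut point: two choices
    differ by a segment, on which locally integrable functions are integrable. *)
Lemma integrable_near_end (R : realType) (a b : \bar R) (e : endpoint) (c c' : R)
    (f : R -> R) : L1loc (ooitv a b) f -> ooitv a b c -> ooitv a b c' ->
  leb.-integrable (near_end a b e c') (EFin \o f) ->
  leb.-integrable (near_end a b e c) (EFin \o f).
Proof.
move=> Lf cab cab' fi.
have mI : measurable (`[Num.min c c', Num.max c c']%classic : set (measurableTypeR R)).
  exact: measurable_itv.
have mN := measurable_near_end a b e.
have fI : leb.-integrable `[Num.min c c', Num.max c c']%classic (EFin \o f).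
  apply: Lf; first exact: segment_compact.
  have [cc'|c'c] := leP c c'; move=> x /=; rewrite in_itv/=; exact: ooitv_between.
have mU := borel_leb_measurable (measurableU _ _ (mN c') mI).
have mC := borel_leb_measurable (mN c).
exact: (integrableS mU mC (near_end_cover cab cab') (integrable_union (mN c') mI fi fI)).
Qed.

Lemma primitive_bounded (R : realType) (a b : \bar R) (k K : R -> R) (c : R) :
  leb.-integrable (ooitv a b) (EFin \o k) -> ooitv a b c ->
  (forall s t, ooitv a b s -> ooitv a b t -> s <= t ->
     (K t - K s)%:E = (\int[leb]_(x in `[s, t]) (k x)%:E)%E) ->
  exists M : R, forall x, ooitv a b x -> `|K x - K c| <= M.
Proof.
move=> ki cab KE; have mJ := borel_leb_measurable (measurable_ooitv a b).
have bnd s t : ooitv a b s -> ooitv a b t -> s <= t ->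
    (`|K t - K s|%:E <= \int[leb]_(x in ooitv a b) `|(k x)%:E|)%E.
  move=> sab tab st; rewrite -abse_EFin KE//.
  have mI : measurable (`[s, t]%classic : set (lebT R)).
    by apply: borel_leb_measurable; exact: measurable_itv.
  have sub : `[s, t]%classic `<=` ooitv a b.
    by move=> x /=; rewrite in_itv/=; exact: ooitv_between.
  have mk := measurable_int _ ki.
  apply: (le_trans (le_abse_integral _ mI _)).
    exact: (measurable_funS mJ sub mk).
  apply: ge0_subset_integral; [exact: mI|exact: mJ|exact: measurableT_comp mk| |exact: sub].
  by move=> x _; exact: abse_ge0.
have fin : (\int[leb]_(x in ooitv a b) `|(k x)%:E|)%E \is a fin_num.
  by apply: integrable_fin_num => //; exact: integrable_abse ki.
exists (fine (\int[leb]_(x in ooitv a b) `|(k x)%:E|)%E) => x xab.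
rewrite -lee_fin fineK//; have [cx|/ltW xc] := leP c x; first exact: bnd.
by rewrite distrC; exact: bnd.
Qed.

(** Monotone convergence along an exhaustion, applied to the absolute value of [f] since
    [f] may be negative on a null set. *)
Lemma integral_le_of_segments (R : realType) (a b : \bar R) (f : R -> R) (M : R) :
  L1loc (ooitv a b) f -> {ae leb, forall x : R, ooitv a b x -> 0 <= f x} ->
  (exists c, ooitv a b c) ->
  (forall s t, ooitv a b s -> ooitv a b t -> s <= t ->
     (\int[leb]_(x in `[s, t]) (f x)%:E <= M%:E)%E) ->
  (\int[leb]_(x in ooitv a b) (f x)%:E <= M%:E)%E.
Proof.
move=> Lf f0 [c cab] H; have mf := L1loc_measurable Lf.
have mJ := borel_leb_measurable (measurable_ooitv a b).
have [x [y [xy mono _ E]]] := ooitv_exhaust cab.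
have sub n : `[x n, y n]%classic `<=` ooitv a b.
  by move=> t /=; rewrite in_itv/=; have [? ? _ _] := xy n; exact: ooitv_between.
have mfE : measurable_fun (ooitv a b : set (lebT R)) (EFin \o f).
  exact/measurable_EFinP.
have mafE : measurable_fun (ooitv a b : set (lebT R))
    (EFin \o (fun t => `|f t|)).
  by apply/measurable_EFinP; exact: (L1loc_measurable (L1loc_abs Lf)).
have mI n : measurable (`[x n, y n]%classic : set (lebT R)).
  by apply: borel_leb_measurable; exact: measurable_itv.
have abs D : measurable (D : set (lebT R)) -> D `<=` ooitv a b ->
    (\int[leb]_(x in D) (f x)%:E = \int[leb]_(x in D) `|f x|%:E)%E.
  move=> mD Dab; have mfD : measurable_fun (D : set (lebT R)) (EFin \o f).
    exact: (measurable_funS mJ Dab mfE).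
  apply: ae_eq_integral.
  - exact: mD.
  - exact: mfD.
  - exact: (measurable_funS mJ Dab mafE).
  - by apply: filterS f0 => t /= ft /Dab /ft t0; rewrite ger0_norm.
rewrite abs//.
have := @ge0_nondecreasing_set_cvg_integral _ (lebT R) R
  (fun n => `[x n, y n]%classic) (fun t => `|f t|%:E) leb _ mI _ _.
rewrite -E => cv.
apply: (cvge_le _ (cv _ _ _)).
- by apply: nearW => n; rewrite -abs//; have [? ? xc cy] := xy n; apply: H => //; rewrite ltW// (lt_trans xc).
- by move=> m n mn; apply/subsetPset; exact: mono.
- by move=> n; exact: (measurable_funS mJ (@sub n) mafE).
- by move=> n t _; rewrite lee_fin.
Qed.

(** * Domination of a principal solution *)

(** The quotient g = s / u has derivative W / (p u^2) of constant sign, so g is W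
    times the monotone function G whose increments are unbounded near the endpoint
    because u is principal.  Near the cut point c, where u does not vanish, g stays
    bounded by M1; hence the growth happens towards the endpoint and |g| >= 1
    there. *)
Lemma principal_dominated (R : realType) (a b : \bar R) (e : endpoint)
    (P u wu s ws : R -> R) (W c : R) :
  L1loc (ooitv a b) P -> {ae leb, forall x : R, ooitv a b x -> 0 < P x} ->
  ac_deriv a b u (fun x => P x * wu x) -> ac_deriv a b s (fun x => P x * ws x) ->
  W != 0 -> (forall x, ooitv a b x -> u x * ws x - wu x * s x = W) ->
  ooitv a b c -> (forall x, near_end a b e c x \/ x = c -> u x != 0) ->
  (\int[leb]_(x in near_end a b e c) ((u x * u x)^-1 * P x)%:E = +oo)%E ->
  exists2 c', ooitv a b c' & forall x, near_end a b e c' x -> `|u x| <= `|s x|.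
Proof.
move=> LP P0 du ds W0 WE cab u0 intoo.
have Jab := near_end_sub (e := e) cab.
pose f x := (u x * u x)^-1 * P x.
pose g x := s x * (u x)^-1.
have W0' : 0 < `|W| by rewrite normr_gt0.
have [G [GE Gmono Gunb]] : exists G : R -> R, [/\
    forall x y, near_end a b e c x -> near_end a b e c y -> g y - g x = W * (G y - G x),
    forall x y, near_end a b e c x -> near_end a b e c y -> x <= y -> G x <= G y &
    forall M : R, exists x y, [/\ near_end a b e c x, near_end a b e c y, x <= y & M < G y - G x]].
  have exJ := near_end_exists e cab.
  move: Jab u0 intoo exJ; have [a' [b' ->]] := near_end_ooitv a b e c => Jab u0 intoo exJ.
  have u0' x : ooitv a' b' x -> u x != 0 by move=> h; apply: u0; left.
  have uu0 x : ooitv a' b' x -> u x * u x != 0 by move=> h; rewrite mulf_neq0// u0'.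
  have du' := ac_deriv_sub Jab du; have ds' := ac_deriv_sub Jab ds.
  have LP' := L1loc_sub Jab LP.
  have f0 : {ae leb, forall x : R, ooitv a' b' x -> 0 <= f x}.
    apply: filterS P0 => x h xJ; rewrite mulr_ge0// ?(ltW (h (Jab _ xJ)))//.
    by rewrite invr_ge0 -expr2 sqr_ge0.
  have [acuu _] := ac_deriv_inv (ac_deriv_mul du' du') uu0.
  have Lf : L1loc (ooitv a' b') f.
    by apply: L1loc_mull LP' => x; exact: ACloc_continuous.
  have [G dG GI] := L1loc_primitive Lf.
  have Gmono x y : ooitv a' b' x -> ooitv a' b' y -> x <= y -> G x <= G y.
    by apply: ae_deriv_ge0_le dG f0.
  exists G; split=> //.
  - move=> x y xJ yJ.
    have dgG := ac_deriv_add (ac_deriv_mul ds' (ac_deriv_inv du' u0'))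
      (ac_deriv_opp (ac_deriv_mul (ac_deriv_cst a' b' W) dG)).
    have := ae_deriv0_const dgG _ xJ yJ; rewrite /g => H.
    suff : s x / u x - W * G x = s y / u y - W * G y by lra.
    apply: H; apply: aeW => t tJ /=; have ut := u0' _ tJ.
    by rewrite -(WE t (Jab _ tJ)) /f; field.
  - move=> M; apply: contrapT => nM.
    suff : (\int[leb]_(x in ooitv a' b') (f x)%:E <= M%:E)%E by rewrite intoo.
    apply: integral_le_of_segments => // x y xJ yJ xy; rewrite -GI// lee_fin leNgt.
    by apply/negP => h; apply: nM; exists x, y.
have [c1 c1J] := near_end_exists e cab.
have [M1 M10 gM1] : exists2 M1, 0 < M1 &
    forall x, Num.min c1 c <= x <= Num.max c1 c -> `|g x| <= M1.
  apply: continuous_itv_bounded => x xI.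
  have xab : ooitv a b x.
    move: xI; have [_|_] := leP c1 c; apply: ooitv_between => //; exact: Jab.
  have ux : u x != 0.
    apply: u0; have [->|xc] := eqVneq x c; [by right|left].
    move: c1J xI; case: (e) => -[/= h1 h2].
      move: h2; rewrite lte_fin => h2; rewrite (min_idPl (ltW h2)) (max_idPr (ltW h2)).
      move=> /andP[c1x xc']; split; last by rewrite lte_fin lt_neqAle xc.
      by apply: lt_le_trans h1 _; rewrite lee_fin.
    move: h1; rewrite lte_fin => h1; rewrite (min_idPr (ltW h1)) (max_idPl (ltW h1)).
    move=> /andP[cx xc1]; split; first by rewrite lte_fin lt_neqAle eq_sym xc.
    by apply: le_lt_trans h2; rewrite lee_fin.
  apply: cvgM; first by apply: ACloc_continuous xab; case: ds.
  by apply: cvgV => //; apply: ACloc_continuous xab; case: du.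
have gc1 : `|g c1| <= M1 by apply: gM1; rewrite ge_min lexx le_max lexx.
have dist x y : near_end a b e c x -> near_end a b e c y -> x <= y ->
    `|W| * (G y - G x) = `|g y - g x|.
  by move=> xJ yJ xy; rewrite GE// normrM (ger0_norm (x := G y - G x))// subr_ge0 Gmono.
(* An increment of g beyond [3 * M1 + 1], of which the part on the side of [c] accounts
   for at most [2 * M1], leaves [M1 + 1] between g(c1) and the endpoint side. *)
have [x0 [y0 [x0J y0J xy0]]] := Gunb ((3 * M1 + 1) / `|W|).
rewrite ltr_pdivrMr// mulrC => Hxy.
have large x : near_end a b e c x -> M1 + 1 <= `|g x - g c1| -> `|u x| <= `|s x|.
  move=> xJ h; have ux : u x != 0 by apply: u0; left.
  have g1 : 1 <= `|g x| by have := ler_normB (g x) (g c1); lra.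
  have -> : s x = g x * u x by rewrite /g; field.
  by rewrite normrM ler_peMl.
have close x : Num.min c1 c <= x <= Num.max c1 c -> `|g x - g c1| <= 2 * M1.
  by move=> /gM1 h; rewrite (le_trans (ler_normB _ _))//; lra.
clear GE Gunb intoo WE du ds LP P0.
case: e => [|] in Jab u0 Gmono c1J dist x0J y0J large *.
- exists x0; first exact: Jab.
  have [ax0 x0c] := x0J; have [ac1 c1c] := c1J; have [ay0 y0c] := y0J.
  rewrite !lte_fin in x0c c1c y0c.
  have h1 : `|W| * (G y0 - G c1) <= 2 * M1.
    have [yc|cy] := leP y0 c1.
      apply: (@le_trans _ _ 0); last by rewrite mulr_ge0// ltW.
      by rewrite pmulr_rle0// subr_le0; exact: Gmono.
    rewrite dist//; [|exact: ltW]; apply: close.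
    by rewrite (min_idPl (ltW c1c)) (max_idPr (ltW c1c)) !ltW.
  move=> x [ax xx0]; rewrite lte_fin in xx0.
  have xJ : near_end a b left_end c x by split=> //; rewrite lte_fin (lt_trans xx0).
  have Gx : G x <= G x0 by apply: Gmono => //; exact: ltW.
  have h2 : `|W| * (G x0 - G x) >= 0 by rewrite pmulr_rge0// subr_ge0.
  apply: large => //; have [xc|cx] := leP x c1.
    by rewrite distrC -dist//; lra.
  have : 0 <= `|W| * (G x - G c1) by rewrite pmulr_rge0// subr_ge0 Gmono// ltW.
  lra.
- exists y0; first exact: Jab.
  have [x0c ax0] := x0J; have [c1c ac1] := c1J; have [y0c ay0] := y0J.
  rewrite !lte_fin in x0c c1c y0c.
  have h1 : `|W| * (G c1 - G x0) <= 2 * M1.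
    have [yc|cy] := leP c1 x0.
      apply: (@le_trans _ _ 0); last by rewrite mulr_ge0// ltW.
      by rewrite pmulr_rle0// subr_le0; exact: Gmono.
    rewrite dist//; [|exact: ltW]; rewrite distrC; apply: close.
    by rewrite (min_idPr (ltW c1c)) (max_idPl (ltW c1c)) !ltW.
  move=> x [xx0 ax]; rewrite lte_fin in xx0.
  have xJ : near_end a b right_end c x by split=> //; rewrite lte_fin (lt_trans _ xx0).
  have Gx : G y0 <= G x by apply: Gmono => //; exact: ltW.
  have h2 : `|W| * (G x - G y0) >= 0 by rewrite pmulr_rge0// subr_ge0.
  apply: large => //; have [xc|cx] := leP c1 x.
    by rewrite -dist//; lra.
  have : 0 <= `|W| * (G c1 - G x) by rewrite pmulr_rge0// subr_ge0 Gmono// ltW.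
  lra.
Qed.

(** * Solutions and their real systems *)

Lemma system_of_solution (R : realType) (a b : \bar R) (p q r : R -> R) (z : R[i])
    (psi : R -> R[i]) :
  {ae leb, forall x : R, ooitv a b x -> 0 < p x} ->
  solution a b p q r z psi ->
  exists w1 w2 : R -> R, solution_system a b (fun x => (p x)^-1)
    (fun x => q x - complex.Re z * r x) (fun x => complex.Im z * r x)
    (fun x => complex.Re (psi x)) w1 (fun x => complex.Im (psi x)) w2.
Proof.
move=> p0 [[ac1 ac2] [w [[ac3 ac4] hu hw]]].
exists (fun x => complex.Re (w x)), (fun x => complex.Im (w x)).
have dd (F : R -> R) x : derivable F x 1 -> is_derive x (1 : R) F (derive1 F x).
  by move=> dF; apply: DeriveDef; [exact: dF|rewrite derive1E].
split; split=> //.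
- apply: filterS2 hu p0 => x h1 h2 xab; have [[d1 _] wE] := h1 xab.
  apply: is_derive_eq (dd _ _ d1) _; have px := lt0r_neq0 (h2 xab).
  by rewrite wE /cderive /= mul0r subr0 mulKf.
- apply: filterS hw => x h1 xab; have [[d1 _] wE] := h1 xab.
  apply: is_derive_eq (dd _ _ d1) _; move: wE; rewrite /cderive.
  case: (psi x) => u1 u2; case: z {h1} => z1 z2 /(congr1 (fun t => complex.Re t)) /=.
  by rewrite !mul0r !mulr0 !subr0 ?add0r ?addr0 => h; lra.
- apply: filterS2 hu p0 => x h1 h2 xab; have [[_ d1] wE] := h1 xab.
  apply: is_derive_eq (dd _ _ d1) _; have px := lt0r_neq0 (h2 xab).
  by rewrite wE /cderive /= mul0r addr0 mulKf.
- apply: filterS hw => x h1 xab; have [[_ d1] wE] := h1 xab.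
  apply: is_derive_eq (dd _ _ d1) _; move: wE; rewrite /cderive.
  case: (psi x) => u1 u2; case: z {h1} => z1 z2 /(congr1 (fun t => complex.Im t)) /=.
  by rewrite !mul0r !mulr0 ?add0r ?addr0 => h; lra.
Qed.

Lemma solution_of_system (R : realType) (a b : \bar R) (p q r : R -> R) (z : R[i])
    (v1 x1 v2 x2 : R -> R) :
  {ae leb, forall x : R, ooitv a b x -> 0 < p x} ->
  solution_system a b (fun x => (p x)^-1)
    (fun x => q x - complex.Re z * r x) (fun x => complex.Im z * r x) v1 x1 v2 x2 ->
  solution a b p q r z (fun x => Complex (v1 x) (v2 x)).
Proof.
move=> p0 [[a1 d1] [a2 d2] [a3 d3] [a4 d4]].
have dd (F : R -> R) x y : is_derive x (1 : R) F y -> derivable F x 1 /\ derive1 F x = y.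
  by move=> [dF <-]; split; [exact: dF|rewrite derive1E].
split; first exact: (conj a1 a3).
exists (fun x => Complex (x1 x) (x2 x)); split; first exact: (conj a2 a4).
- apply: filterS3 p0 d1 d3 => x h0 h1 h2 xab.
  have [e1 e1'] := dd _ _ _ (h1 xab); have [e2 e2'] := dd _ _ _ (h2 xab).
  split; first exact: (conj e1 e2).
  have px := lt0r_neq0 (h0 xab).
  by rewrite /cderive /= e1' e2' /=; apply/eqP; rewrite eq_complex/= !mul0r subr0 addr0 !mulVKf// !eqxx.
- apply: filterS2 d2 d4 => x h1 h2 xab.
  have [e1 e1'] := dd _ _ _ (h1 xab); have [e2 e2'] := dd _ _ _ (h2 xab).
  split; first exact: (conj e1 e2).
  rewrite /cderive /= e1' e2' /=; case: z {h1 h2 e1' e2'} => z1 z2 /=.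
  apply/eqP; rewrite eq_complex/= !mul0r !mulr0 !subr0 ?add0r ?addr0.
  by apply/andP; split; apply/eqP; ring.
Qed.

Lemma wronskian_const (R : realType) (a b : \bar R) (P Q u wu s ws : R -> R) (c x : R) :
  ac_deriv a b u (fun x => P x * wu x) -> ac_deriv a b wu (fun x => Q x * u x) ->
  ac_deriv a b s (fun x => P x * ws x) -> ac_deriv a b ws (fun x => Q x * s x) ->
  ooitv a b c -> ooitv a b x ->
  u x * ws x - wu x * s x = u c * ws c - wu c * s c.
Proof.
move=> du dwu ds dws cab xab.
have dW := ac_deriv_add (ac_deriv_mul du dws) (ac_deriv_opp (ac_deriv_mul dwu ds)).
by apply: (ae_deriv0_const dW) => //; apply: aeW => t _; ring.
Qed.

(** The combination s - (s(c) / u(c)) u has zero Cauchy data at c. *)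
Lemma proportional (R : realType) (a b : \bar R) (P Q u wu s ws : R -> R) (c x : R) :
  L1loc (ooitv a b) P -> L1loc (ooitv a b) Q ->
  ac_deriv a b u (fun x => P x * wu x) -> ac_deriv a b wu (fun x => Q x * u x) ->
  ac_deriv a b s (fun x => P x * ws x) -> ac_deriv a b ws (fun x => Q x * s x) ->
  ooitv a b c -> u c != 0 -> u c * ws c - wu c * s c = 0 ->
  ooitv a b x -> s x = s c / u c * u x.
Proof.
move=> LP LQ du dwu ds dws cab uc W0 xab.
pose k := s c / u c.
have dlin F G f g := fun df dg => @ac_deriv_add R a b F _ f _ df
   (ac_deriv_mul (ac_deriv_cst a b (- k)) (dg : ac_deriv a b G g)).
have L0 : L1loc (ooitv a b) (fun=> 0 : R).
  have := L1loc_mull (f := fun=> 0) _ LP; rewrite (_ : (fun x => 0 * P x) = fun=> 0).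
    by apply=> y _; exact: cst_continuous.
  by apply/funext => y; rewrite mul0r.
have sys : solution_system a b P Q (fun=> 0) (fun x => s x + (- k) * u x)
    (fun x => ws x + (- k) * wu x) (fun=> 0) (fun=> 0).
  split.
  - by apply: (ac_deriv_eq (dlin _ _ _ _ ds du)); apply: aeW => y _; ring.
  - by apply: (ac_deriv_eq (dlin _ _ _ _ dws dwu)); apply: aeW => y _; ring.
  - by apply: (ac_deriv_eq (ac_deriv_cst a b 0)); apply: aeW => y _; ring.
  - by apply: (ac_deriv_eq (ac_deriv_cst a b 0)); apply: aeW => y _; ring.
have := solution_system_eq0 LP LQ L0 sys cab xab.
have s0 : s c + (- k) * u c = 0 by rewrite /k; field.
have w0 : ws c + (- k) * wu c = 0.
  by apply: (mulfI uc); rewrite mulr0 -W0 /k; field.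
rewrite /= s0 w0 !expr0n/= !addr0 => /(_ erefl)/eqP.
by rewrite paddr_eq0 ?sqr_ge0// sqrf_eq0 => /andP[/eqP + _]; rewrite -/k; lra.
Qed.

(** * Limit point case and square integrable solutions *)

Lemma ae_exists (R : realType) (a b : \bar R) (A : R -> Prop) : (exists c, ooitv a b c) ->
  {ae leb, forall x : R, ooitv a b x -> A x} -> exists2 x, ooitv a b x & A x.
Proof.
move=> [c cab] aeA; apply: contrapT => nA.
have [x [y [xy _ _ _]]] := ooitv_exhaust cab; have [xab yab xc cy] := xy 0%N.
have /leb_negligible[/= B [mB B0 sB]] := aeA.
have sub : `[x 0%N, y 0%N]%classic `<=` B.
  move=> t /=; rewrite in_itv/= => tI; apply: sB => /= At; apply: nA.
  have tab := ooitv_between xab yab tI; by exists t => //; exact: At.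
have mI : measurable (`[x 0%N, y 0%N]%classic : set (measurableTypeR R)).
  exact: measurable_itv.
have : (lebesgue_measure (`[x 0%N, y 0%N]%classic : set (measurableTypeR R)) <= lebesgue_measure B)%E.
  by apply: le_measure; rewrite ?inE.
rewrite [leLHS](lebesgue_measure_itv `[x 0%N, y 0%N]) /= lte_fin (lt_trans xc cy) -EFinB.
by rewrite [leRHS](B0 : _ = 0%E) lee_fin subr_le0 leNgt (lt_trans xc cy).
Qed.

Lemma is_derive_unique (R : realType) (F G : R -> R) (x f g : R) :
  (\forall y \near x, F y = G y) ->
  is_derive x (1 : R) F f -> is_derive x (1 : R) G g -> f = g.
Proof.
move=> FG dF dG; have dF' := near_eq_is_derive FG dF.
by rewrite -(@derive_val _ _ _ _ _ _ _ dF') -(@derive_val _ _ _ _ _ _ _ dG).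
Qed.

Lemma near_end_dominated (R : realType) (a b : \bar R) (e : endpoint) (c : R) (f g : R -> R) :
  ooitv a b c -> L1loc (ooitv a b) f ->
  (forall x, near_end a b e c x -> `|f x| <= `|g x|) ->
  leb.-integrable (near_end a b e c) (EFin \o g) ->
  leb.-integrable (near_end a b e c) (EFin \o f).
Proof.
move=> cab Lf fg ig.
have mJ := borel_leb_measurable (measurable_near_end a b e c).
have mab := borel_leb_measurable (measurable_ooitv a b).
apply: (le_integrable mJ _ _ ig); last by move=> x Jx /=; rewrite lee_fin; exact: fg.
apply/measurable_EFinP.
exact: (measurable_funS mab (near_end_sub (e := e) cab) (L1loc_measurable Lf)).
Qed.

Lemma normc_sqr (R : realType) (x y : R) :
  ComplexField.Normc.normc (Complex x y) ^+ 2 = x ^+ 2 + y ^+ 2.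
Proof. by rewrite /= sqr_sqrtr// addr_ge0// sqr_ge0. Qed.

(** Weyl's alternative: if two solutions at lambda with nonzero Wronskian are square
    integrable, then both solutions of a fundamental system at lambda + i are, one of
    them being the solution psi that the limit point case singles out.  A multiple of psi
    has zero determinant with psi, whereas the second solution has determinant 1. *)
Lemma limit_point_wronskian_eq0 (R : realType) (a b : \bar R) (p q r : R -> R) (e : endpoint)
    (lambda c : R) (u wu s ws : R -> R) :
  {ae leb, forall x : R, ooitv a b x -> 0 < p x} ->
  {ae leb, forall x : R, ooitv a b x -> 0 < r x} ->
  L1loc (ooitv a b) (fun x => (p x)^-1) -> L1loc (ooitv a b) q -> L1loc (ooitv a b) r ->
  let P := fun x => (p x)^-1 in let Q := fun x => q x - lambda * r x in
  ac_deriv a b u (fun x => P x * wu x) -> ac_deriv a b wu (fun x => Q x * u x) ->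
  ac_deriv a b s (fun x => P x * ws x) -> ac_deriv a b ws (fun x => Q x * s x) ->
  ooitv a b c ->
  leb.-integrable (near_end a b e c) (EFin \o (fun x => (u x * u x + s x * s x) * r x)) ->
  limit_point_case a b p q r e -> u c * ws c - wu c * s c = 0.
Proof.
move=> p0 r0 ip iq ir P Q du dwu ds dws cab ius lpc; apply/eqP/negP => /negP W0.
set W := u c * ws c - wu c * s c in W0.
have WE x : ooitv a b x -> u x * ws x - wu x * s x = W.
  exact: wronskian_const du dwu ds dws cab.
have cont F f : ac_deriv a b F f -> forall x, ooitv a b x -> {for x, continuous F}.
  by move=> [acF _] x; exact: ACloc_continuous.
have LZ k f : L1loc (ooitv a b) f -> L1loc (ooitv a b) (fun x => k * f x).
  by apply: L1loc_mull => x _; exact: cst_continuous.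
have LQ : L1loc (ooitv a b) Q.
  have := L1loc_add iq (LZ (- lambda) _ ir).
  by congr L1loc; apply/funext => x; rewrite /Q mulNr.
have Lr : L1loc (ooitv a b) (fun x => 1 * r x) by exact: LZ.
have dus := ac_deriv_add (ac_deriv_mul du du) (ac_deriv_mul ds ds).
have Lk : L1loc (ooitv a b) (fun x => (u x * u x + s x * s x) * (1 * r x)).
  exact: (L1loc_mull (cont _ _ dus) Lr).
have Im0 : complex.Im (Complex lambda 1) != 0 by rewrite /= oner_neq0.
have [c0 c0ab [psi [solpsi ntpsi Lpsi uniq]]] := lpc _ Im0.
have [w1 [w2]] := system_of_solution p0 solpsi.
set psi1 := fun x => complex.Re _; set psi2 := fun x => complex.Im _ => sys.
have N0 x : ooitv a b x -> psi1 x ^+ 2 + psi2 x ^+ 2 + w1 x ^+ 2 + w2 x ^+ 2 != 0.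
  move=> xab; apply/negP => /eqP Nx; have [y yab psiy] := ntpsi.
  have := solution_system_eq0 ip LQ Lr sys xab yab Nx.
  move/eqP; rewrite !paddr_eq0 ?addr_ge0 ?sqr_ge0// !sqrf_eq0 => /andP[/andP[/andP[h1 h2] _] _].
  move: h1 h2 psiy; rewrite /psi1 /psi2; case: (psi y) => z1 z2 /= /eqP-> /eqP->.
  by rewrite eq_complex /= eqxx.
have [v1 [x1 [v2 [x2 [sysv det]]]]] := second_solution ip LQ Lr sys N0.
have solphi := @solution_of_system _ a b p q r (Complex lambda 1) v1 x1 v2 x2 p0 sysv.
set phi := fun x => Complex (v1 x) (v2 x) in solphi.
(* The determinant excludes that phi is a multiple of psi; p (phi)' = k p psi' holds
   almost everywhere, and one such point suffices. *)
suff [k phik] : exists k : R[i], forall x, ooitv a b x -> phi x = k * psi x.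
  have [P1 P2 P3 P4] := sys; have [P1' P2' P3' P4'] := sysv.
  pose k1 := complex.Re k; pose k2 := complex.Im k.
  have v1E x : ooitv a b x -> v1 x = k1 * psi1 x + - (k2 * psi2 x).
    move=> xab; have := congr1 (fun t => complex.Re t) (phik x xab).
    by rewrite /phi /k1 /k2 /psi1 /psi2; case: (k) => ? ?; case: (psi x).
  have v2E x : ooitv a b x -> v2 x = k1 * psi2 x + k2 * psi1 x.
    move=> xab; have := congr1 (fun t => complex.Im t) (phik x xab).
    by rewrite /phi /k1 /k2 /psi1 /psi2; case: (k) => ? ?; case: (psi x).
  have [_ D1] := ac_deriv_add (ac_deriv_mul (ac_deriv_cst a b k1) P1)
    (ac_deriv_opp (ac_deriv_mul (ac_deriv_cst a b k2) P3)).
  have [_ D2] := ac_deriv_add (ac_deriv_mul (ac_deriv_cst a b k1) P3)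
    (ac_deriv_mul (ac_deriv_cst a b k2) P1).
  have near_ab (F G : R -> R) x : ooitv a b x -> (forall y, ooitv a b y -> F y = G y) ->
      \forall y \near x, F y = G y.
    move=> xab FG; have : nbhs x (ooitv a b).
      by apply: open_nbhs_nbhs; split=> //; exact: open_ooitv.
    by apply: filterS => y /FG.
  have aeE : {ae leb, forall x : R, ooitv a b x ->
      x1 x = k1 * w1 x - k2 * w2 x /\ x2 x = k1 * w2 x + k2 * w1 x}.
    have d1 : {ae leb, forall x : R, ooitv a b x -> x1 x = k1 * w1 x - k2 * w2 x}.
      case: P1' => _ P1'; apply: filterS3 p0 P1' D1 => x h0 h1 h2 xab.
      have px := lt0r_neq0 (h0 xab).
      have := is_derive_unique (near_ab _ _ _ xab v1E) (h1 xab) (h2 xab).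
      rewrite /= !mul0r !add0r => h.
      by apply: (mulfI (invr_neq0 px)); rewrite h; ring.
    have d2 : {ae leb, forall x : R, ooitv a b x -> x2 x = k1 * w2 x + k2 * w1 x}.
      case: P3' => _ P3'; apply: filterS3 p0 P3' D2 => x h0 h1 h2 xab.
      have px := lt0r_neq0 (h0 xab).
      have := is_derive_unique (near_ab _ _ _ xab v2E) (h1 xab) (h2 xab).
      rewrite /= !mul0r !add0r => h.
      by apply: (mulfI (invr_neq0 px)); rewrite h; ring.
    by apply: filterS2 d1 d2 => x h1 h2 xab; split; [exact: h1|exact: h2].
  have [x xab [x1E x2E]] := ae_exists (ex_intro _ c cab) aeE.
  have h := det x xab; rewrite x1E x2E v1E// v2E// in h.
  have : (1 : R) = 0 by rewrite -h; ring.
  by move/eqP; rewrite oner_eq0.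
(* The zero function is a multiple of psi, so phi may be taken nontrivial. *)
have [nt|nnt] := pselect (nontrivial a b phi); last first.
  exists 0 => x xab; rewrite mul0r; apply/eqP; apply: contrapT => /negP h.
  by apply: nnt; exists x.
apply: uniq => //.
have [K dK KI] := L1loc_primitive Lk.
have [y0 y0J] := near_end_exists e c0ab; have Jab := near_end_sub (e := e) c0ab.
have Lk1 : L1loc (ooitv a b) (fun x => (u x * u x + s x * s x) * r x).
  exact: (L1loc_mull (cont _ _ dus) ir).
have ik := integrable_near_end Lk1 c0ab cab ius.
have [M KM] : exists M : R, forall x, near_end a b e c0 x -> `|K x - K y0| <= M.
  move: Jab y0J ik; have [a' [b' ->]] := near_end_ooitv a b e c0 => Jab y0J ik.
  apply: primitive_bounded => //; last first.
    by move=> x y xJ yJ xy; rewrite KI//; exact: Jab.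
  by congr (leb.-integrable _ _) : ik; apply/funext => x /=; rewrite mul1r.
have r0' : {ae leb, forall x : R, ooitv a b x -> 0 < 1 * r x}.
  by apply: filterS r0 => x h xab; rewrite mul1r h.
have [N N0' bnd] := solution_bound r0' du dwu ds dws W0 WE dK sysv (Jab _ y0J).
pose C := N * expR (`|W|^-1 * M).
have ius0 : leb.-integrable (near_end a b e c0)
    (EFin \o (fun x => C * ((u x * u x + s x * s x) * r x))).
  have mJ := borel_leb_measurable (measurable_near_end a b e c0).
  have := integrableZl mJ C ik.
  by congr (leb.-integrable _ _); apply/funext => x /=; rewrite EFinM.
have dv := ac_deriv_add (let: And4 h _ _ _ := sysv in ac_deriv_mul h h)
  (let: And4 _ _ h _ := sysv in ac_deriv_mul h h).
have Lv : L1loc (ooitv a b) (fun x => (v1 x * v1 x + v2 x * v2 x) * r x).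
  exact: (L1loc_mull (cont _ _ dv) ir).
have := near_end_dominated c0ab Lv _ ius0; rewrite /L2.
rewrite (_ : (fun x => _%:E) = EFin \o (fun x => (v1 x * v1 x + v2 x * v2 x) * r x)).
  apply=> x xJ /=; rewrite -!expr2 mulrA 2!normrM (normrM C) ler_wpM2r//.
  have C0 : 0 <= C by rewrite mulr_ge0// expR_ge0.
  rewrite !(ger0_norm (addr_ge0 (sqr_ge0 _) (sqr_ge0 _))) (ger0_norm C0).
  apply: (le_trans (bnd x (Jab _ xJ))); rewrite ler_wpM2r ?addr_ge0 ?sqr_ge0//.
  by rewrite ler_wpM2l// ler_expR ler_wpM2l ?invr_ge0// KM.
by apply/funext => x /=; rewrite normc_sqr !expr2.
Qed.

(** The claims on the real and on the imaginary part of psi are the same, hence the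
    auxiliary fact on a real solution s with s^2 <= |psi|^2; their two
    constants are the real and imaginary parts of the factor. *)
Lemma L2_solution_principal (R : realType) (a b : \bar R) (p q r : R -> R) (e : endpoint)
    (lambda : R) (psi : R -> R[i]) (u : R -> R) :
  {ae leb, forall x : R, ooitv a b x -> 0 < p x} ->
  {ae leb, forall x : R, ooitv a b x -> 0 < r x} ->
  L1loc (ooitv a b) (fun x => (p x)^-1) -> L1loc (ooitv a b) q -> L1loc (ooitv a b) r ->
  limit_point_case a b p q r e ->
  L2_solution a b p q r e (real_complex R lambda) psi -> principal a b p q r e lambda u ->
  exists2 k : R[i], k != 0 &
    forall x : R, ooitv a b x -> psi x = k * real_complex R (u x).
Proof.
move=> p0 r0 ip iq ir lpc [solpsi ntpsi [c1 c1ab Lpsi]] [solu [c cab [u0 intoo]]].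
have uc : u c != 0 by apply: u0; right.
pose P x := (p x)^-1; pose Q x := q x - lambda * r x.
have [wu [wu2 [du' dwu' _ _]]] := system_of_solution p0 solu.
have du : ac_deriv a b u (fun x => P x * wu x) by exact: du'.
have dwu : ac_deriv a b wu (fun x => Q x * u x).
  by apply: (ac_deriv_eq dwu'); apply: aeW => x _ /=; rewrite /Q; ring.
have cont F f : ac_deriv a b F f -> forall x, ooitv a b x -> {for x, continuous F}.
  by move=> [acF _] x; exact: ACloc_continuous.
have LQ : L1loc (ooitv a b) Q.
  have Lr : L1loc (ooitv a b) (fun x => - lambda * r x).
    by apply: L1loc_mull ir => x _; exact: cst_continuous.
  by have := L1loc_add iq Lr; congr L1loc; apply/funext => x; rewrite /Q mulNr.
have key s ws : ac_deriv a b s (fun x => P x * ws x) -> ac_deriv a b ws (fun x => Q x * s x) ->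
    (forall x, s x ^+ 2 <= ComplexField.Normc.normc (psi x) ^+ 2) ->
    forall x, ooitv a b x -> s x = s c / u c * u x.
  move=> ds dws spsi x xab.
  apply: (proportional ip LQ du dwu ds dws cab uc) => //.
  apply: contrapT => /eqP W0.
  have intoo' : (\int[leb]_(y in near_end a b e c) ((u y * u y)^-1 * P y)%:E = +oo)%E.
    by rewrite -intoo; apply: eq_integral => y _; rewrite mulrC -expr2.
  have WE y : ooitv a b y -> u y * ws y - wu y * s y = u c * ws c - wu c * s c.
    exact: wronskian_const du dwu ds dws cab.
  have p0' : {ae leb, forall y : R, ooitv a b y -> 0 < P y}.
    by apply: filterS p0 => y h yab; rewrite invr_gt0 h.
  have [c' c'ab us] := principal_dominated ip p0' du ds W0 WE cab u0 intoo'.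
  have dss := ac_deriv_mul ds ds.
  have Ls : L1loc (ooitv a b) (fun y => (s y * s y) * r y).
    exact: (L1loc_mull (cont _ _ dss) ir).
  have is1 : leb.-integrable (near_end a b e c1) (EFin \o (fun y => (s y * s y) * r y)).
    apply: (near_end_dominated c1ab Ls _ Lpsi) => y _ /=.
    rewrite [leLHS]normrM [leRHS]normrM ler_wpM2r// -expr2 !ger0_norm ?sqr_ge0//.
  have is' := integrable_near_end Ls c'ab c1ab is1.
  have mJ := borel_leb_measurable (measurable_near_end a b e c').
  have i2s := integrableZl mJ 2 is'.
  have dus := ac_deriv_add (ac_deriv_mul du du) dss.
  have Lus : L1loc (ooitv a b) (fun y => (u y * u y + s y * s y) * r y).
    exact: (L1loc_mull (cont _ _ dus) ir).
  have ius : leb.-integrable (near_end a b e c') (EFin \o (fun y => (u y * u y + s y * s y) * r y)).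
    apply: (near_end_dominated (g := fun y => 2 * ((s y * s y) * r y)) c'ab Lus).
      move=> y yJ; rewrite mulrA [leLHS]normrM [leRHS]normrM ler_wpM2r//.
      rewrite -!expr2 !ger0_norm ?addr_ge0 ?(mulr_ge0 (ler0n _ 2)) ?sqr_ge0//.
      have : u y ^+ 2 <= s y ^+ 2.
        by rewrite -(real_normK (num_real (u y))) -(real_normK (num_real (s y))) lerXn2r ?nnegrE// us.
      lra.
    by congr (leb.-integrable _ _) : i2s; apply/funext => y /=; rewrite EFinM.
  have := limit_point_wronskian_eq0 p0 r0 ip iq ir du dwu ds dws c'ab ius lpc.
  by rewrite WE// => /eqP; rewrite (negbTE W0).
have [w1 [w2 [d1 dw1' d2 dw2']]] := system_of_solution p0 solpsi.
pose psi1 x := complex.Re (psi x); pose psi2 x := complex.Im (psi x).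
have dw1 : ac_deriv a b w1 (fun x => Q x * psi1 x).
  by apply: (ac_deriv_eq dw1'); apply: aeW => x _ /=; rewrite /Q /psi1; ring.
have dw2 : ac_deriv a b w2 (fun x => Q x * psi2 x).
  by apply: (ac_deriv_eq dw2'); apply: aeW => x _ /=; rewrite /Q /psi2; ring.
have E1 := key psi1 w1 d1 dw1; have E2 := key psi2 w2 d2 dw2.
have {}E1 x : ooitv a b x -> psi1 x = psi1 c / u c * u x.
  apply: E1 => y; rewrite /psi1; case: (psi y) => z1 z2; rewrite normc_sqr /=.
  by rewrite lerDl sqr_ge0.
have {}E2 x : ooitv a b x -> psi2 x = psi2 c / u c * u x.
  apply: E2 => y; rewrite /psi2; case: (psi y) => z1 z2; rewrite normc_sqr /=.
  by rewrite lerDr sqr_ge0.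
have kE x : ooitv a b x ->
    psi x = Complex (psi1 c / u c) (psi2 c / u c) * real_complex R (u x).
  move=> xab; have := E1 x xab; have := E2 x xab; rewrite {1}/psi1 {1}/psi2.
  by case: (psi x) => z1 z2 /= -> ->; apply/eqP; rewrite eq_complex/= !mulr0 subr0 add0r !eqxx.
exists (Complex (psi1 c / u c) (psi2 c / u c)) => //.
apply/negP => /eqP k0; have [x xab] := ntpsi.
by rewrite kE// k0 mul0r eqxx.
Qed.

(** * Weyl-Titchmarsh solutions are principal *)

Local Open Scope complex_scope.

Theorem theorem2p13 (R : realType) (a b : \bar R) (p q r : R -> R)
  (hab : (a < b)%E)
  (mp : lebesgue_measurable (ooitv a b) p)
  (mq : lebesgue_measurable (ooitv a b) q)
  (mr : lebesgue_measurable (ooitv a b) r)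
  (p_gt0 : {ae leb, forall x : R, ooitv a b x -> 0 < p x})
  (r_gt0 : {ae leb, forall x : R, ooitv a b x -> 0 < r x})
  (ip : L1loc (ooitv a b) (fun x => (p x)^-1))
  (iq : L1loc (ooitv a b) q)
  (ir : L1loc (ooitv a b) r) :
  (nonoscillatory a b p q r left_end -> limit_point_case a b p q r left_end ->
   exists lambda_a : R, forall lambda : R, lambda < lambda_a ->
     forall (psi : R -> R[i]) (u : R -> R),
       weyl_titchmarsh a b p q r left_end lambda psi ->
       principal a b p q r left_end lambda u ->
       (forall x x0 : R, ooitv a b x -> ooitv a b x0 ->
          (forall t : R, ooitv a b t -> psi t = 0 \/ u t = 0 ->
             x < t /\ x0 < t) ->
          psi x * (psi x0)^-1 = (u x * (u x0)^-1)%:C) /\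
       (exists2 k : R[i], k != 0 &
          forall x : R, ooitv a b x -> psi x = k * (u x)%:C))
  /\
  (nonoscillatory a b p q r right_end -> limit_point_case a b p q r right_end ->
   exists lambda_b : R, forall lambda : R, lambda < lambda_b ->
     forall (psi : R -> R[i]) (u : R -> R),
       weyl_titchmarsh a b p q r right_end lambda psi ->
       principal a b p q r right_end lambda u ->
       (forall x x0 : R, ooitv a b x -> ooitv a b x0 ->
          (forall t : R, ooitv a b t -> psi t = 0 \/ u t = 0 ->
             t < x /\ t < x0) ->
          psi x * (psi x0)^-1 = (u x * (u x0)^-1)%:C) /\
       (exists2 k : R[i], k != 0 &
          forall x : R, ooitv a b x -> psi x = k * (u x)%:C)).
Proof.
have ratio (psi : R -> R[i]) (u : R -> R) (k : R[i]) : k != 0 ->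
    (forall x, ooitv a b x -> psi x = k * (u x)%:C) ->
    forall x x0, ooitv a b x -> ooitv a b x0 ->
      psi x * (psi x0)^-1 = (u x * (u x0)^-1)%:C.
  move=> k0 psiE x x0 xab x0ab.
  by rewrite psiE// psiE// invfM mulrACA divff// mul1r rmorphM fmorphV.
(* All real lambda are treated alike, hence an arbitrary threshold. *)
split=> _ lpc; exists 0 => lambda _ psi u [mu [Psi [_ lmu [_ _ HPsi] ->]]] pu.
- have [k k0 kE] := L2_solution_principal p_gt0 r_gt0 ip iq ir lpc (HPsi _ lmu) pu.
  split; last by exists k.
  by move=> x x0 xab x0ab _; exact: ratio kE _ _ xab x0ab.
- have [k k0 kE] := L2_solution_principal p_gt0 r_gt0 ip iq ir lpc (HPsi _ lmu) pu.
  split; last by exists k.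
  by move=> x x0 xab x0ab _; exact: ratio kE _ _ xab x0ab.
Qed.
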